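(* Assume that $\eta,\nu,\kappa$ satisfy, for all admissible phase values $s\in[0,1]$, $$0<\eta_{\min}\le\eta(s)\le\eta_{\max},\qquad 0\le\nu_{\min}\le\nu(s)\le\nu_{\max},\qquad 0<\kappa_{\min}\le\kappa(s)\le\kappa_{\max},$$ and let $(\vec v_h^{\,n},\tilde\pi_h^{\,n},\varphi_h^{\,n},\xi_h^{\,n},\vec\zeta_h^{\,n})\in\vec V_h\times Q_h^0\times V_h\times V_h\times\vec W_h$, $n=0,1,\dots,N$, be generated by the fully discrete splitting scheme described in the context. For each $n$ define $\widehat\varphi_h^{\,n}:=\mathcal T(\varphi_h^{\,n})=\min\{1,\max\{0,\varphi_h^{\,n}\}\}$. Set $$\mathcal E_h^n:=\frac{\rho\,\mathrm{Re}}2\|\vec v_h^{\,n}\|_{L^2(\omega)}^2+\frac12\|\varphi_h^{\,n}\|_{L^2(\omega)}^2+\frac12\|\vec\zeta_h^{\,n}\|_{L^2(\omega)}^2,$$ $$\begin{aligned}\mathcal D_h^{n+1}:={}&\frac{\tau}{4\lambda}\|\xi_h^{\,n+1}\|_{L^2(\omega)}^2+\frac12\big(\eta(\widehat\varphi_h^{\,n+1})\nabla\vec v_h^{\,n+1},\nabla\vec v_h^{\,n+1}\big)\\&+\frac12\Big(\frac{\eta(\widehat\varphi_h^{\,n+1})}{\kappa(\widehat\varphi_h^{\,n+1})}(1-\widehat\varphi_h^{\,n+1})\vec v_h^{\,n+1},\vec v_h^{\,n+1}\Big)+\epsilon\big(\nu(\widehat\varphi_h^{\,n+1})\nabla\vec\zeta_h^{\,n+1},\nabla\vec\zeta_h^{\,n+1}\big),\end{aligned}$$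 and $$\begin{aligned}\mathcal S_h^n:={}&\alpha_\phi^2\|I_H(\phi^n-\varphi_h^{\,n})\|_{L^2(\omega)}^2+\alpha_\psi^2\|I_H(\vec\psi^{\,n}-\vec\zeta_h^{\,n})\|_{L^2(\omega)}^2+\alpha_u^2\|I_H(\vec u^{\,n}-\vec v_h^{\,n})\|_{L^2(\omega)}^2\\&+\|f(\widehat\varphi_h^{\,n})\|_{L^2(\omega)}^2+\|\nu'(\widehat\varphi_h^{\,n})|\nabla\vec\zeta_h^{\,n}|^2\|_{L^2(\omega)}^2+\|2\tilde\pi_h^{\,n}-\tilde\pi_h^{\,n-1}\|_{L^2(\omega)}^2\\&+\|\xi_h^{\,n+1}\nabla\varphi_h^{\,n+1}\|_{L^2(\omega)}^2+\|\nu'(\widehat\varphi_h^{\,n+1})|\nabla\vec\zeta_h^{\,n+1}|^2\nabla\varphi_h^{\,n+1}\|_{L^2(\omega)}^2\\&+\|\nu(\widehat\varphi_h^{\,n+1})(\nabla\vec\zeta_h^{\,n+1})^T\nabla\vec\zeta_h^{\,n+1}\|_{L^2(\omega)}^2.\end{aligned}$$ Then there exist constants $C>0$ and $\Delta t_0>0$, depending only on $\omega,\rho,\mathrm{Re},\tau,\lambda,\epsilon,\eta_{\min},\eta_{\max},\nu_{\max}$ and $\kappa_{\min}$, such that for every $0<\Delta t\le\Delta t_0$ and every $n=0,\dots,N-1$, $$\mathcal E_h^{n+1}+\Delta t\,\mathcal D_h^{n+1}\le(1+C\Delta t)\,\mathcal E_h^n+C\Delta t\,\mathcal S_h^n.$$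 Consequently, if $T=N\Delta t$, then for every $m\le N$, $$\mathcal E_h^m+\Delta t\sum_{n=0}^{m-1}\mathcal D_h^{n+1}\le e^{CT}\Big(\mathcal E_h^0+C\Delta t\sum_{n=0}^{m-1}\mathcal S_h^n\Big).$$
   Context: **Setting.** $\omega\subset\mathbb R^2$ is a bounded simply connected domain with $C^2$ boundary, $\mathcal T_h$ is a conforming triangulation of $\omega$, and $(\cdot,\cdot)$ is the $L^2(\omega)$ inner product (for scalars, vectors or matrices). $P_r(K)$ denotes the scalar polynomials of total degree at most $r$ on the triangle $K$. Define $$V_h=\{\vartheta_h\in C^0(\overline\omega):\vartheta_h|_K\in P_2(K)\ \forall K\in\mathcal T_h\},\quad Q_h=\{q_h\in C^0(\overline\omega):q_h|_K\in P_1(K)\ \forall K\in\mathcal T_h\},$$ $$Q_h^0=\Big\{q_h\in Q_h:\int_\omega q_h\,dx=0\Big\},\quad \vec V_h=\{\vec w_h\in[V_h]^2:\vec w_h=\vec0\text{ on }\partial\omega\},\quad \vec W_h=[V_h]^2.$$ The constants $\rho,\mathrm{Re},\lambda,\gamma,\tau,\epsilon>0$ and the nudging parameters $\alpha_u,\alpha_\phi,\alpha_\psi\ge0$ are fixed; $\Delta t>0$ is the time step, $N$ the number of steps, and $t^n=n\Delta t$. The functions $\eta,\nu,\kappa$ are in $C^1(\mathbb R)$ with derivatives bounded on bounded sets. $F\in C^2(\mathbb R)$ is a double-well potential, $f:=F'$, with $|f(s)|\le C_f(1+|s|^{q-1})$ and $F(s)\ge c_F|s|^q-C_F$ for all $s\in\mathbb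 R$ (for some $q\ge3$, $C_f,c_F>0$, $C_F\ge0$). $I_H$ is a linear observation operator (applied componentwise to vectors), mapping sufficiently regular fields on $\omega$ into an observation space, with $\|w-I_Hw\|_{L^2(\omega)}^2\le\frac14c_0^2\,\delta^4\|w\|_{H^2(\omega)}^2$ for all $w\in H^2(\omega)$, where $\delta>0$ is the observational resolution and $c_0>0$ is independent of $\delta$. The fields $\vec u^{\,n},\phi^n,\vec\psi^{\,n}$ are the reference (observed) velocity, phase and auxiliary field at time $t^n$; they enter only through the given data $I_H(\phi^n-\varphi_h^{\,n})$, $I_H(\vec\psi^{\,n}-\vec\zeta_h^{\,n})$, $I_H(\vec u^{\,n}-\vec v_h^{\,n})$, which are elements of $L^2(\omega)$ (resp. $L^2(\omega)^2$). Truncation: $\mathcal T(s):=\min\{1,\max\{0,s\}\}$ for $s\in\mathbb R$, and $\widehat\varphi_h^{\,n}:=\mathcal T(\varphi_h^{\,n})$ pointwise. Transport forms: for $\vec a\in\vec V_h$, $r,s\in V_h$, $\vec z,\vec\theta\in\vec W_h$, $\vec b,\vec w\in\vec V_h$, $$b_\phi(\vec a;r,s)=-(r\vec a,\nabla s)-\tfrac12((\nabla\cdot\vec a)r,s),$$ $$b_\psi(\vec a;\vec z,\vec\theta)=((\vec a\cdot\nabla)\vec z,\vec\theta)+\tfrac12((\nabla\cdot\vec a)\vec z,\vec\theta),\qquad c(\vec a;\vec b,\vec w)=((\vec a\cdot\nabla)\vec b,\vec w)+\tfrac12((\nabla\cdot\vec a)\vec b,\vec w).$$ Convention: $(\nabla\vec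 a)_{kj}=\partial_ja_k$. **The scheme.** Initial data $(\vec v_h^{\,0},\varphi_h^{\,0},\vec\zeta_h^{\,0})\in\vec V_h\times V_h\times\vec W_h$ and initial pressure guesses $\tilde\pi_h^{\,0},\tilde\pi_h^{\,-1}\in Q_h^0$ are given ($\xi_h^{\,0}$ plays no role). For $n=0,\dots,N-1$ compute successively: (i) Cahn–Hilliard step: $(\varphi_h^{\,n+1},\xi_h^{\,n+1})\in V_h\times V_h$ such that for all $(\vartheta_h,\chi_h)\in V_h\times V_h$ $$\Big(\tfrac{\varphi_h^{\,n+1}-\varphi_h^{\,n}}{\Delta t},\vartheta_h\Big)+b_\phi(\vec v_h^{\,n};\varphi_h^{\,n+1},\vartheta_h)+\tau(\nabla\xi_h^{\,n+1},\nabla\vartheta_h)=(\alpha_\phi I_H(\phi^n-\varphi_h^{\,n}),\vartheta_h),$$ $$(\xi_h^{\,n+1},\chi_h)-\lambda(\nabla\varphi_h^{\,n+1},\nabla\chi_h)=\lambda\gamma(f(\widehat\varphi_h^{\,n}),\chi_h)+\tfrac12(\nu'(\widehat\varphi_h^{\,n})|\nabla\vec\zeta_h^{\,n}|^2,\chi_h).$$ (ii) Auxiliary-field step: $\vec\zeta_h^{\,n+1}\in\vec W_h$ such that for all $\vec\theta_h\in\vec W_h$ $$\Big(\tfrac{\vec\zeta_h^{\,n+1}-\vec\zeta_h^{\,n}}{\Delta t},\vec\theta_h\Big)+b_\psi(\vec v_h^{\,n};\vec\zeta_h^{\,n+1},\vec\theta_h)+\epsilon(\nu(\widehat\varphi_h^{\,n+1})\nabla\vec\zeta_h^{\,n+1},\nabla\vec\theta_h)=(\alpha_\psi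 I_H(\vec\psi^{\,n}-\vec\zeta_h^{\,n}),\vec\theta_h).$$ (iii) Navier–Stokes step and pressure correction: $\vec v_h^{\,n+1}\in\vec V_h$ such that for all $\vec w_h\in\vec V_h$ $$\begin{aligned}&\Big(\tfrac{\rho\mathrm{Re}}{\Delta t}\vec v_h^{\,n+1},\vec w_h\Big)+\rho\mathrm{Re}\,c(\vec v_h^{\,n};\vec v_h^{\,n+1},\vec w_h)+(\eta(\widehat\varphi_h^{\,n+1})\nabla\vec v_h^{\,n+1},\nabla\vec w_h)+\Big(\tfrac{\eta(\widehat\varphi_h^{\,n+1})}{\kappa(\widehat\varphi_h^{\,n+1})}(1-\widehat\varphi_h^{\,n+1})\vec v_h^{\,n+1},\vec w_h\Big)\\&=\Big(\tfrac{\rho\mathrm{Re}}{\Delta t}\vec v_h^{\,n},\vec w_h\Big)+(2\tilde\pi_h^{\,n}-\tilde\pi_h^{\,n-1},\nabla\cdot\vec w_h)+(\xi_h^{\,n+1}\nabla\varphi_h^{\,n+1},\vec w_h)-\tfrac12(\nu'(\widehat\varphi_h^{\,n+1})|\nabla\vec\zeta_h^{\,n+1}|^2\nabla\varphi_h^{\,n+1},\vec w_h)\\&\quad-(\nu(\widehat\varphi_h^{\,n+1})(\nabla\vec\zeta_h^{\,n+1})^T\nabla\vec\zeta_h^{\,n+1},\nabla\vec w_h)+(\alpha_uI_H(\vec u^{\,n}-\vec v_h^{\,n}),\vec w_h);\end{aligned}$$ then $\tilde\pi_h^{\,n+1}\in Q_h^0$ such that for all $q_h\in Q_h^0$ $$(\nabla\tilde\pi_h^{\,n+1},\nabla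 q_h)=\Big(\tfrac{\rho\mathrm{Re}}{\Delta t}\nabla\cdot\vec v_h^{\,n+1},q_h\Big)-(\nabla\tilde\pi_h^{\,n},\nabla q_h).$$
   Formalization: The constants C and Δt_0 are also allowed to depend on γ, which the statement's list omits; without this the estimate fails for large γ (constant φ_h = s with f(s) ≠ 0, zero velocity and auxiliary field, no nudging). *)

(* Defs.v *)
(* MathComp-Analysis; points of the plane are pairs of reals with the product
   topology, and integrals are Lebesgue integrals for the product measure. *)
From HB Require Import structures.
From mathcomp Require Import all_boot all_order all_algebra.
From mathcomp Require Import all_classical all_reals all_analysis.

Set Implicit Arguments.
Unset Strict Implicit.
Unset Printing Implicit Defensive.

Import Order.TTheory GRing.Theory Num.Theory numFieldNormedType.Exports.

Local Open Scope classical_set_scope.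
Local Open Scope ring_scope.

Notation leb2 := (lebesgue_measure \x lebesgue_measure)%E.

Section Calculus.
Context {R : realType}.

(* All scalar, vector and matrix fields are total functions on the plane; only
   their values on the (closed) domain are ever used. *)
Definition dir (j : 'I_2) : R * R := if j == 0 then (1, 0) else (0, 1).

Definition partial (j : 'I_2) (s : R * R -> R) : R * R -> R :=
  fun x => 'D_(dir j) s x.

Definition component (k : 'I_2) (a : R * R -> 'cV[R]_2) : R * R -> R :=
  fun x => a x k 0.

Definition grad (s : R * R -> R) : R * R -> 'cV[R]_2 :=
  fun x => \col_j partial j s x.

Definition jac (a : R * R -> 'cV[R]_2) : R * R -> 'M[R]_2 :=
  fun x => \matrix_(k, j) partial j (component k a) x.

Definition dvg (a : R * R -> 'cV[R]_2) : R * R -> R := fun x => \tr (jac a x).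

Definition frob (m n : nat) (A B : 'M[R]_(m, n)) : R := \tr (A^T *m B).

Definition ip (omega : set (R * R)) (f g : R * R -> R) : R :=
  \int[leb2]_(x in omega) (f x * g x).

Definition mip (omega : set (R * R)) (m n : nat)
    (A B : R * R -> 'M[R]_(m, n)) : R :=
  \int[leb2]_(x in omega) frob (A x) (B x).

Definition sqnorm (omega : set (R * R)) (f : R * R -> R) : R := ip omega f f.

Definition msqnorm (omega : set (R * R)) (m n : nat)
    (A : R * R -> 'M[R]_(m, n)) : R := mip omega A A.

Definition L2 (omega : set (R * R)) (f : R * R -> R) : Prop :=
  measurable_fun omega f /\
  leb2.-integrable omega (fun x => ((f x) ^+ 2)%:E).

Definition C1 (g : R -> R) : Prop :=
  (forall s, derivable g s 1) /\ continuous (derive1 g).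

Definition C2 (g : R -> R) : Prop := C1 g /\ C1 (derive1 g).

Definition C1_bounded (g : R -> R) : Prop :=
  C1 g /\ forall M : R, exists L : R,
    forall s, `|s| <= M -> `|derive1 g s| <= L.

End Calculus.

Section Domain.
Context {R : realType}.

Definition bd (A : set (R * R)) : set (R * R) := closure A `\` A°.

Definition simply_connected (A : set (R * R)) : Prop :=
  forall g : R -> R * R,
    {within `[0, 1], continuous g} -> g @` `[0, 1] `<=` A -> g 0 = g 1 ->
  exists H : R * R -> R * R,
    [/\ {within `[0, 1] `*` `[0, 1], continuous H},
        H @` (`[0, 1] `*` `[0, 1]) `<=` A,
        forall s, 0 <= s <= 1 -> H (s, 0) = g s /\ H (s, 1) = g 0 &
        forall t, 0 <= t <= 1 -> H (0, t) = g 0 /\ H (1, t) = g 0].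

(* Near each boundary point, in a rotated orthonormal frame (a, b), (-b, a)
   centred at it, A is the strict subgraph of a C^2 function. *)
Definition C2_boundary (A : set (R * R)) : Prop :=
  forall x : R * R, bd A x ->
  exists (r a b : R) (g : R -> R),
    [/\ 0 < r, a ^+ 2 + b ^+ 2 = 1, C2 g &
        forall y : R * R, ball x r y ->
          (A y <-> - b * (y.1 - x.1) + a * (y.2 - x.2)
                     < g (a * (y.1 - x.1) + b * (y.2 - x.2)))].

Definition admissible_domain (A : set (R * R)) : Prop :=
  [/\ open A, connected A, A !=set0, bounded_set A &
      simply_connected A /\ C2_boundary A].

End Domain.

Section Triangulation.
Context {R : realType}.

Definition bary (i : 'I_3) (p : R * R) : R :=
  nth 0 [:: 1 - p.1 - p.2; p.1; p.2] i.

Definition ref_triangle : set (R * R) := [set p | forall i, 0 <= bary i p].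

Definition ref_vertex (i : 'I_3) : set (R * R) :=
  ref_triangle `&` [set p | bary i p = 1].

(* the edge opposite to vertex i *)
Definition ref_edge (i : 'I_3) : set (R * R) :=
  ref_triangle `&` [set p | bary i p = 0].

Definition homeomorphism (G : R * R -> R * R) : Prop :=
  continuous G /\
  exists2 H : R * R -> R * R, continuous H & cancel G H /\ cancel H G.

Definition segment (p q : R * R) : set (R * R) :=
  [set (1 - t) *: p + t *: q | t in `[0, 1]].

(* A mesh is a finite family of homeomorphisms of the plane; the i-th element
   is the image of the reference triangle under the i-th one, and its vertices
   and edges are the images of the reference vertices and edges. *)
Definition elt (m : nat) (G : 'I_m -> R * R -> R * R) (i : 'I_m) :
  set (R * R) := G i @` ref_triangle.

(* Straight triangles cannot cover a domain with C^2 boundary exactly, so an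
   edge is a straight segment unless it is an arc of the boundary. *)
Definition conforming_triangulation (omega : set (R * R))
    (m : nat) (G : 'I_m -> R * R -> R * R) : Prop :=
  [/\ forall i, homeomorphism (G i),
      \bigcup_i elt G i = closure omega,
      forall i a, G i @` ref_edge a `<=` bd omega \/
        exists p q, G i @` ref_edge a = segment p q &
      forall i j, i != j ->
        [\/ elt G i `&` elt G j = set0,
            exists a b, elt G i `&` elt G j = G i @` ref_vertex a /\
                        elt G i `&` elt G j = G j @` ref_vertex b |
            exists a b, elt G i `&` elt G j = G i @` ref_edge a /\
                        elt G i `&` elt G j = G j @` ref_edge b]].

End Triangulation.

Section Spaces.
Context {R : realType}.
Variables (omega : set (R * R)) (m : nat) (G : 'I_m -> R * R -> R * R).

Definition poly_on (r : nat) (K : set (R * R)) (s : R * R -> R) : Prop :=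
  exists c : nat -> nat -> R, forall x, K x ->
    s x = \sum_(i < r.+1) \sum_(j < r.+1 | (i + j <= r)%N)
            c i j * x.1 ^+ i * x.2 ^+ j.

Definition lagrange (r : nat) (s : R * R -> R) : Prop :=
  {within closure omega, continuous s} /\
  forall i, poly_on r (elt G i) s.

Definition Vh (s : R * R -> R) : Prop := lagrange 2 s.
Definition Qh (s : R * R -> R) : Prop := lagrange 1 s.

Definition Qh0 (s : R * R -> R) : Prop :=
  Qh s /\ \int[leb2]_(x in omega) s x = 0.

Definition vecWh (a : R * R -> 'cV[R]_2) : Prop :=
  forall k, Vh (component k a).

Definition vecVh (a : R * R -> 'cV[R]_2) : Prop :=
  vecWh a /\ forall x, bd omega x -> a x = 0.

End Spaces.

Section Sobolev.
Context {R : realType}.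
Variable omega : set (R * R).

Definition smooth (s : R * R -> R) : Prop :=
  forall l : seq 'I_2, let g := foldr partial s l in
    continuous g /\ forall j x, derivable g x (dir j).

Definition test_function (s : R * R -> R) : Prop :=
  smooth s /\ exists2 K : set (R * R), compact K /\ K `<=` omega &
    forall x, ~ K x -> s x = 0.

Definition weak_partial (j : 'I_2) (w g : R * R -> R) : Prop :=
  forall s, test_function s -> ip omega w (partial j s) = - ip omega g s.

Definition H2_with (w : R * R -> R) (g : 'I_2 -> R * R -> R)
    (h : 'I_2 -> 'I_2 -> R * R -> R) : Prop :=
  [/\ L2 omega w, forall i, L2 omega (g i), forall i j, L2 omega (h i j),
      forall i, weak_partial i w (g i) &
      forall i j, weak_partial j (g i) (h i j)].

Definition H2_sqnorm (w : R * R -> R) (g : 'I_2 -> R * R -> R)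
    (h : 'I_2 -> 'I_2 -> R * R -> R) : R :=
  sqnorm omega w + \sum_i sqnorm omega (g i)
  + \sum_i \sum_j sqnorm omega (h i j).

(* dom is the space of fields that are regular enough to be observed. *)
Definition observation_operator (c0 delta : R) (dom : set (R * R -> R))
    (IH : (R * R -> R) -> R * R -> R) : Prop :=
  [/\ forall w g h, H2_with w g h -> dom w,
      forall w, dom w -> L2 omega (IH w),
      forall k w1 w2, dom w1 -> dom w2 -> dom (fun x => k * w1 x + w2 x),
      forall k w1 w2, dom w1 -> dom w2 ->
        {ae leb2, forall x, omega x ->
          IH (fun y => k * w1 y + w2 y) x = k * IH w1 x + IH w2 x} &
      forall w g h, H2_with w g h ->
        sqnorm omega (fun x => w x - IH w x)
          <= 4%:R^-1 * c0 ^+ 2 * delta ^+ 4 * H2_sqnorm w g h].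

End Sobolev.

Section Scheme.
Context {R : realType}.

Record physical := Physical {
  par_rho : R; par_Re : R; par_lambda : R; par_gamma : R;
  par_tau : R; par_eps : R }.

Record nudging := Nudging { nud_u : R; nud_phi : R; nud_psi : R }.

Record material := Material {
  mat_eta : R -> R; mat_nu : R -> R; mat_kappa : R -> R; mat_F : R -> R }.

(* the first argument is time *)
Record reference := Reference {
  ref_u : R -> R * R -> 'cV[R]_2;
  ref_phi : R -> R * R -> R;
  ref_psi : R -> R * R -> 'cV[R]_2 }.

(* The n-th iterates of the scheme; it_pi_init is the pressure at index -1 and
   the value of it_xi at 0 is irrelevant. *)
Record iterates := Iterates {
  it_v : nat -> R * R -> 'cV[R]_2;
  it_phi : nat -> R * R -> R;
  it_xi : nat -> R * R -> R;
  it_zeta : nat -> R * R -> 'cV[R]_2;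
  it_pi : nat -> R * R -> R;
  it_pi_init : R * R -> R }.

(* There is no canonical definition of "double well"; two local minima
   separated by a strictly higher barrier is what the term entails. *)
Definition double_well (F : R -> R) : Prop :=
  exists a c b : R, [/\ a < c < b, F a < F c, F b < F c,
    \forall y \near a, F a <= F y & \forall y \near b, F b <= F y].

Definition potential_growth (F : R -> R) : Prop :=
  exists q Cf cF CF : R, [/\ 3%:R <= q, 0 < Cf, 0 < cF, 0 <= CF &
    forall s : R, `|derive1 F s| <= Cf * (1 + `|s| `^ (q - 1)) /\
                  cF * `|s| `^ q - CF <= F s].

Definition trunc (s : R) : R := Num.min 1 (Num.max 0 s).

Variable omega : set (R * R).

Definition b_phi (a : R * R -> 'cV[R]_2) (r s : R * R -> R) : R :=
  - mip omega (fun x => r x *: a x) (grad s)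
  - 2^-1 * ip omega (fun x => dvg a x * r x) s.

(* serves as both b_psi and c *)
Definition b_vec (a z th : R * R -> 'cV[R]_2) : R :=
  mip omega (fun x => jac z x *m a x) th
  + 2^-1 * mip omega (fun x => dvg a x *: z x) th.

Variables (m : nat) (G : 'I_m -> R * R -> R * R).
Variables (P : physical) (A : nudging) (M : material).
Variables (IH : (R * R -> R) -> R * R -> R) (ref : reference).
Variables (dt : R) (sol : iterates).

Local Notation v := (it_v sol).
Local Notation phi := (it_phi sol).
Local Notation xi := (it_xi sol).
Local Notation zeta := (it_zeta sol).
Local Notation p := (it_pi sol).

Definition IHvec (a : R * R -> 'cV[R]_2) : R * R -> 'cV[R]_2 :=
  fun x => \col_k IH (component k a) x.

Definition time (n : nat) : R := n%:R * dt.

Definition phi_err (n : nat) : R * R -> R :=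
  fun x => ref_phi ref (time n) x - phi n x.
Definition psi_err (n : nat) : R * R -> 'cV[R]_2 :=
  fun x => ref_psi ref (time n) x - zeta n x.
Definition u_err (n : nat) : R * R -> 'cV[R]_2 :=
  fun x => ref_u ref (time n) x - v n x.

Definition observable (dom : set (R * R -> R)) (n : nat) : Prop :=
  dom (phi_err n) /\
  forall k, dom (component k (psi_err n)) /\ dom (component k (u_err n)).

Definition hphi (n : nat) : R * R -> R := fun x => trunc (phi n x).

Definition p_extrap (n : nat) : R * R -> R := fun x =>
  2%:R * p n x - (if n is k.+1 then p k else it_pi_init sol) x.

(* nu'(hphi^k) |grad zeta^n|^2 *)
Definition nu_stress (k n : nat) : R * R -> R := fun x =>
  derive1 (mat_nu M) (hphi k x) * frob (jac (zeta n) x) (jac (zeta n) x).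

Definition elastic (n : nat) : R * R -> 'M[R]_2 := fun x =>
  mat_nu M (hphi n x) *: ((jac (zeta n) x)^T *m jac (zeta n) x).

Definition drag (n : nat) : R * R -> 'cV[R]_2 := fun x =>
  (mat_eta M (hphi n x) / mat_kappa M (hphi n x) * (1 - hphi n x)) *: v n x.

Definition cahn_hilliard_step (n : nat) : Prop :=
  forall th ch, Vh omega G th -> Vh omega G ch ->
  (ip omega (fun x => (phi n.+1 x - phi n x) / dt) th
   + b_phi (v n) (phi n.+1) th
   + par_tau P * mip omega (grad (xi n.+1)) (grad th)
   = ip omega (fun x => nud_phi A * IH (phi_err n) x) th) /\
  (ip omega (xi n.+1) ch - par_lambda P * mip omega (grad (phi n.+1)) (grad ch)
   = par_lambda P * par_gamma P
       * ip omega (fun x => derive1 (mat_F M) (hphi n x)) ch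
     + 2^-1 * ip omega (nu_stress n n) ch).

Definition auxiliary_step (n : nat) : Prop :=
  forall th, vecWh omega G th ->
  mip omega (fun x => dt^-1 *: (zeta n.+1 x - zeta n x)) th
  + b_vec (v n) (zeta n.+1) th
  + par_eps P * mip omega (fun x => mat_nu M (hphi n.+1 x) *: jac (zeta n.+1) x)
                      (jac th)
  = mip omega (fun x => nud_psi A *: IHvec (psi_err n) x) th.

Definition navier_stokes_step (n : nat) : Prop :=
  forall w, vecVh omega G w ->
  mip omega (fun x => (par_rho P * par_Re P / dt) *: v n.+1 x) w
  + par_rho P * par_Re P * b_vec (v n) (v n.+1) w
  + mip omega (fun x => mat_eta M (hphi n.+1 x) *: jac (v n.+1) x) (jac w)
  + mip omega (drag n.+1) w
  = mip omega (fun x => (par_rho P * par_Re P / dt) *: v n x) w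
    + ip omega (p_extrap n) (dvg w)
    + mip omega (fun x => xi n.+1 x *: grad (phi n.+1) x) w
    - 2^-1 * mip omega
        (fun x => nu_stress n.+1 n.+1 x *: grad (phi n.+1) x) w
    - mip omega (elastic n.+1) (jac w)
    + mip omega (fun x => nud_u A *: IHvec (u_err n) x) w.

Definition pressure_step (n : nat) : Prop :=
  forall q, Qh0 omega G q ->
  mip omega (grad (p n.+1)) (grad q)
  = ip omega (fun x => par_rho P * par_Re P / dt * dvg (v n.+1) x) q
    - mip omega (grad (p n)) (grad q).

Definition generated_by_scheme (N : nat) : Prop :=
  [/\ Qh0 omega G (it_pi_init sol),
      forall n, (n <= N)%N ->
        [/\ vecVh omega G (v n), Qh0 omega G (p n), Vh omega G (phi n) &
            vecWh omega G (zeta n)],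
      forall n, (n < N)%N -> Vh omega G (xi n.+1) &
      forall n, (n < N)%N ->
        [/\ cahn_hilliard_step n, auxiliary_step n, navier_stokes_step n &
            pressure_step n]].

Definition energy (n : nat) : R :=
  par_rho P * par_Re P / 2 * msqnorm omega (v n)
  + 2^-1 * sqnorm omega (phi n) + 2^-1 * msqnorm omega (zeta n).

Definition dissipation (n : nat) : R :=
  par_tau P / (4%:R * par_lambda P) * sqnorm omega (xi n)
  + 2^-1 * mip omega (fun x => mat_eta M (hphi n x) *: jac (v n) x) (jac (v n))
  + 2^-1 * mip omega (drag n) (v n)
  + par_eps P * mip omega (fun x => mat_nu M (hphi n x) *: jac (zeta n) x)
                      (jac (zeta n)).

Definition source (n : nat) : R :=
  nud_phi A ^+ 2 * sqnorm omega (IH (phi_err n))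
  + nud_psi A ^+ 2 * msqnorm omega (IHvec (psi_err n))
  + nud_u A ^+ 2 * msqnorm omega (IHvec (u_err n))
  + sqnorm omega (fun x => derive1 (mat_F M) (hphi n x))
  + sqnorm omega (nu_stress n n)
  + sqnorm omega (p_extrap n)
  + msqnorm omega (fun x => xi n.+1 x *: grad (phi n.+1) x)
  + msqnorm omega (fun x => nu_stress n.+1 n.+1 x *: grad (phi n.+1) x)
  + msqnorm omega (elastic n.+1).

End Scheme.

Arguments physical : clear implicits.
Arguments nudging : clear implicits.
Arguments material : clear implicits.
Arguments reference : clear implicits.
Arguments iterates : clear implicits.

(* Main.v *)
Require Import Defs.
From HB Require Import structures.
From mathcomp Require Import all_boot all_order all_algebra.
From mathcomp Require Import all_classical all_reals all_analysis.
From mathcomp Require Import measurable_realfun ring lra.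
Set Implicit Arguments.
Unset Strict Implicit.
Unset Printing Implicit Defensive.
Import Order.TTheory GRing.Theory Num.Theory numFieldNormedType.Exports.
Local Open Scope classical_set_scope.
Local Open Scope ring_scope.

(** One step of the scheme is tested with its own solution: the phase equation
    with phi^(n+1), the chemical potential equation with xi^(n+1), the auxiliary
    equation with zeta^(n+1) and the momentum equation with v^(n+1).  Three
    things then happen.

    - The transport terms disappear ([b_phi_eq0], [b_vec_eq0]).  With equal
      arguments each of them is, up to a constant factor, the integral of the
      divergence of r^2 a (summed over the components r of a vector field), and
      the advecting velocity a vanishes on the boundary.

    - The coupling (grad xi, grad phi) is the same number in the two equations
      of the phase step; eliminating it leaves the damping (tau/lambda) |xi|^2
      on the left ([phase_estimate]).

    - All remaining terms are products, split by Young's inequality into a part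
      absorbed by the dissipation, a part of the source and a multiple of the
      new energy.  Hence, with explicit c1 and c2,
        E' + dt D' <= E + dt (c1 E' + c2 S)        ([energy_step]).
      For dt <= 1 / (2 c1) the new energy moves to the left, which gives the
      one-step bound with C = 2 (c1 + c2) ([implicit_euler_step]); iterating it
      and using 1 + x <= exp x gives the second one ([discrete_gronwall]).

    The delicate point is the divergence theorem for a continuous, piecewise
    polynomial w that vanishes on the boundary of omega, since the elements along
    the boundary are curved and only known to be homeomorphic to a triangle.
    Extended by zero, w is Lipschitz in each coordinate direction: a line is
    covered by finitely many closed sets, its intersections with the elements
    and with the complement of omega, and w is Lipschitz on each of them
    ([closed_cover_lipschitz]).  So the difference quotients of w converge
    boundedly to its partial derivative.  By translation invariance the integral
    over omega of a difference quotient with increment h e is carried by the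
    points of omega within h of the complement in direction e, where w = O(h);
    the measure of that strip tends to zero ([integral_partial_eq0]).

    Integrands are controlled only off the element edges.  Inside omega the
    edges are line segments, hence negligible, and integrals over omega are
    replaced by integrals over the open set [mesh_interior], where all discrete
    fields are continuous and bounded. *)

(** * Negligible sets *)

Section NegligibleSets.
Context d (T : measurableType d) (R : realType) (mu : {measure set T -> \bar R}).
Import HBNNSimple.
Local Open Scope ereal_scope.

(** The integral of an arbitrary nonnegative [f] is a supremum over simple
    functions below [f], and each of these may be cut off on [N] without
    changing its integral. *)
Lemma ge0_integral_setD_null (D N : set T) (f : T -> \bar R) :
  measurable N -> mu N = 0 -> (forall x, D x -> 0 <= f x) ->
  \int[mu]_(x in D) f x = \int[mu]_(x in D `\` N) f x.
Proof.
move=> mN N0 f0; apply/eqP; rewrite eq_le; apply/andP; split; last first.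
  rewrite ge0_integralE; last by move=> x [/f0].
  rewrite ge0_integralE//; apply: ereal_sup_le => _ /= [h hf <-]; exists h => //.
  move=> x; apply: le_trans (hf x) _; rewrite !patchE in_setD.
  case: ifPn => [/andP[-> _]//|]; case: ifPn => // /set_mem Dx _; exact: f0.
rewrite ge0_integralE//; apply: ge_ereal_sup => _ /= [h hf <-].
rewrite -integralT_nnsfun (ge0_negligible_integral mN)//; last 2 first.
- exact/measurable_EFinP.
- by move=> x _; rewrite lee_fin.
rewrite ge0_integralE; last by move=> x _; rewrite lee_fin.
rewrite ge0_integralE; last by move=> x [/f0].
apply: ereal_sup_le => _ /= [g gh <-]; exists g => //= x.
apply: le_trans (gh x) _; have := hf x.
rewrite !patchE !in_setD in_setT/=; case: (x \in N) => /=; rewrite ?andbT ?andbF //.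
Qed.

Lemma integral_setD_null (D N : set T) (f : T -> \bar R) :
  measurable N -> mu N = 0 ->
  \int[mu]_(x in D) f x = \int[mu]_(x in D `\` N) f x.
Proof.
move=> mN N0; rewrite integralE [RHS]integralE.
by congr (_ - _); exact: ge0_integral_setD_null.
Qed.

Lemma Rintegral_setD_null (D N : set T) (f : T -> R) :
  measurable N -> mu N = 0 ->
  (\int[mu]_(x in D) f x = \int[mu]_(x in D `\` N) f x)%R.
Proof. by move=> mN N0; rewrite /Rintegral -integral_setD_null. Qed.

End NegligibleSets.

(** * Lebesgue measure on the plane *)

Section Plane.
Context {R : realType}.
Implicit Types (U : set (R * R)) (f : R * R -> R).

(** The measurable sets of the plane are generated by products, so an open set
    has to be written as a countable union of rational rectangles. *)
Lemma open_measurable2 U : open U -> measurable U.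
Proof.
move=> oU.
pose B (q : (rat * rat) * (rat * rat)) : set (R * R) :=
  `]ratr q.1.1, ratr q.1.2[%classic `*` `]ratr q.2.1, ratr q.2.2[%classic.
pose F q := if `[< B q `<=` U >] then B q else set0.
rewrite (_ : U = \bigcup_q F q).
  apply: countable_bigcupT_measurable => // q; rewrite /F; case: ifP => // _.
  by apply: measurableX; exact: measurable_itv.
apply/seteqP; split => [x Ux|x [q _]]; last first.
  by rewrite /F; case: asboolP => // qU; exact: qU.
have /nbhs_ballP[e /= e0 eU] : nbhs x U by move: oU; rewrite openE; exact.
have rat_near (t : R) : exists p : rat * rat,
    ratr p.1 < t < ratr p.2 /\ forall s, ratr p.1 < s < ratr p.2 -> ball t e s.
  have [a /itvP ha] := @rat_in_itvoo _ (t - e) t ltac:(by rewrite ltrBlDr ltrDl).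
  have [b /itvP hb] := @rat_in_itvoo _ t (t + e) ltac:(by rewrite ltrDl).
  exists (a, b) => /=; rewrite ha hb; split => // s /andP[as_ sb].
  rewrite /ball/= distrC ltr_distl.
  by rewrite (lt_trans _ as_) ?ha// (lt_trans sb) ?hb.
have [p [px pe]] := rat_near x.1; have [q [qx qe]] := rat_near x.2.
exists (p, q) => //; rewrite /F; case: asboolP => [_|[]].
  by split => /=; rewrite in_itv.
by move=> y [/=]; rewrite !in_itv/= => /pe hp /qe hq; apply: eU; split.
Qed.

Lemma continuous_measurable2 U f : open U ->
  (forall x, U x -> {for x, continuous f}) -> measurable_fun U f.
Proof.
move=> oU cf mU; apply: (measurability _ (RGenOpens.measurableE R)) => //.
move=> _ [_ [a [b ->] <-]]; apply: open_measurable2.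
rewrite openE => x [Ux fx]; rewrite /interior.
apply: filterI; first by move: oU; rewrite openE; exact.
by apply: cf => //; apply: open_nbhs_nbhs; split => //; exact: interval_open.
Qed.

Lemma vertical_null (c : R) :
  measurable ([set c] `*` [set: R]) /\ leb2 ([set c] `*` [set: R]) = 0%E.
Proof.
by split; [exact: measurableX|rewrite product_measure1E//= lebesgue_measure_set1 mul0e].
Qed.

Lemma graph_null (a b : R) (L := [set x : R * R | x.2 = a * x.1 + b]) :
  measurable L /\ leb2 L = 0%E.
Proof.
have mL : measurable L.
  rewrite -[L]setTI (_ : L = (fun x => x.2 - a * x.1 - b) @^-1` [set 0]).
    apply: continuous_measurable2 => //; first exact: openT.
    move=> x _; apply: continuousB; last exact: cst_continuous.
    by apply: continuousB; [exact: cvg_snd|apply: continuousM;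
      [exact: cst_continuous|exact: cvg_fst]].
  apply/seteqP; split => x; rewrite /L/=; first by move=> ->; ring.
  by move=> h; apply/eqP; rewrite -subr_eq0; apply/eqP; rewrite -h; ring.
split => //; rewrite /product_measure1; under eq_integral.
  move=> x _ /=; rewrite (_ : xsection L x = [set a * x + b]).
    rewrite lebesgue_measure_set1; over.
  by apply/seteqP; split => y; rewrite /xsection/= inE.
by rewrite integral0.
Qed.

Lemma segment_null (p q : R * R) : exists N : set (R * R),
  [/\ measurable N, leb2 N = 0%E & segment p q `<=` N].
Proof.
have [pq|pq] := eqVneq p.1 q.1.
  have [? ?] := vertical_null p.1; exists ([set p.1] `*` setT); split => //.
  by move=> _ [t _ <-]; split => //=; rewrite -pq /GRing.scale/=; ring.
pose a := (q.2 - p.2) / (q.1 - p.1); pose b := p.2 - a * p.1.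
have [? ?] := graph_null a b; exists [set x : R * R | x.2 = a * x.1 + b].
split => // _ [t _ <-] /=; rewrite /b /a; move: pq; rewrite eq_sym -subr_eq0 => pq.
by rewrite /GRing.scale/=; field.
Qed.

Lemma lebesgue_measure_translate (c : R) (A : set R) : measurable A ->
  lebesgue_measure ((fun t => t + c) @^-1` A) = lebesgue_measure A.
Proof.
move=> mA.
have mT : measurable_fun [set: measurableTypeR R]
    ((fun t : R => t + c) : measurableTypeR R -> measurableTypeR R).
  exact: measurable_funD.
rewrite [RHS](@lebesgue_measure_unique _ (measure_function_pushforward__canonical__measure_function_Measure lebesgue_measure mT))//.
move=> _ [[a b] _ <-] /=; rewrite /pushforward.
rewrite (_ : _ @^-1` _ = `]a - c, b - c]%classic).
  rewrite !lebesgue_measure_itv/= !lte_fin ltrD2r.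
  by case: ifP => // _; rewrite -!EFinB; congr EFin; ring.
by apply/seteqP; split => t /=; rewrite !in_itv/= ltrBlDr lerBrDr.
Qed.

(** The image of the product measure under a translation agrees with the product
    measure on rectangles, by the one-dimensional case. *)
Lemma lebesgue2_translate (c : R * R) (A : set (R * R)) : measurable A ->
  leb2 ((fun x => x + c) @^-1` A) = leb2 A.
Proof.
move=> mA.
have mT : measurable_fun [set: measurableTypeR R * measurableTypeR R]
    ((fun x : R * R => x + c) : measurableTypeR R * measurableTypeR R ->
       measurableTypeR R * measurableTypeR R).
  apply: measurable_fun_pair.
    by apply: measurable_funD => //; exact: measurable_fst.
  by apply: measurable_funD => //; exact: measurable_snd.
rewrite [RHS](@product_measure_unique _ _ _ _ _ lebesgue_measure lebesgue_measure
  (measure_function_pushforward__canonical__measure_function_Measure leb2 mT))//.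
move=> X Y mX mY.
transitivity (leb2 (((fun t => t + c.1) @^-1` X) `*` ((fun t => t + c.2) @^-1` Y))) => //.
rewrite product_measure1E.
- by congr (_ * _)%E; exact: lebesgue_measure_translate.
- by rewrite -[_ @^-1` _]setTI; exact: measurable_funD.
- by rewrite -[_ @^-1` _]setTI; exact: measurable_funD.
Qed.

End Plane.

(** * Lipschitz bounds along lines *)

Section Lines.
Context {R : realType}.

(** Induction on the number of closed sets.  If [K i] contains [a] and [c] is its
    last point up to [b], the estimate holds between [a] and [c], and the
    remaining sets cover everything after [c], hence [c] too because they are
    closed. *)
Lemma closed_cover_lipschitz (I : choiceType) (s : seq I) (K : I -> set R)
    (W : R -> R) (L a b : R) :
  (forall i, closed (K i)) ->
  (forall i t u, K i t -> K i u -> t <= u -> `|W u - W t| <= L * (u - t)) ->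
  a <= b ->
  (forall t, a <= t <= b -> exists2 i, i \in s & K i t) ->
  `|W b - W a| <= L * (b - a).
Proof.
move=> cK LK; have [n] := ubnP (size s); elim: n s a => // n IHn s a sn ab cov.
have [i si Kia] := cov a ltac:(by rewrite lexx ab).
pose A := K i `&` `[a, b]%classic.
have Aa : A a by split => //=; rewrite in_itv/= lexx.
have ubA : ubound A b by move=> t [_]/=; rewrite in_itv/= => /andP[].
have A0 : A !=set0 by exists a.
have hA : has_sup A by split => //; exists b.
have [Kic] : A (sup A).
  have cA : closed A by apply: closedI; [exact: cK|exact: interval_closed].
  by rewrite [A in A _](closure_id _).1//; apply: closure_sup => //; exists b.
set c := sup A in Kic *; rewrite /= in_itv/= => /andP[ac cb].
have Wac := LK i a c Kia Kic ac.
have [cb'|cb'] := eqVneq c b; first by rewrite -cb'.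
have cltb : c < b by rewrite lt_neqAle cb'.
pose s' := [seq j <- s | j != i].
have covr t : c < t <= b -> exists2 j, j \in s' & K j t.
  move=> /andP[ct tb]; have [|j js Kj] := cov t.
    by rewrite tb (le_trans ac (ltW ct)).
  exists j => //; rewrite mem_filter js andbT; apply/eqP => ji.
  have : t <= c.
    apply: sup_upper_bound => //; split; first by rewrite -ji.
    by rewrite /= in_itv/= tb (le_trans ac (ltW ct)).
  by rewrite leNgt ct.
(* the remaining sets have a closed union containing points right after c *)
have covc : exists2 j, j \in s' & K j c.
  pose U := \big[setU/set0]_(j <- s') K j.
  have cU : closed U by apply: closed_bigsetU => j _; exact: cK.
  have : U c.
    rewrite [U in U _](closure_id _).1//; move=> B /nbhs_ballP[e /= e0 eB].
    pose t := Num.min b (c + e / 2).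
    have ct : c < t by rewrite lt_min cltb ltrDl divr_gt0.
    exists t; split.
      have [j js Kj] := covr t ltac:(by rewrite ct ge_min lexx).
      by rewrite /U -(bigcup_seq s' K); exists j.
    apply: eB; rewrite /ball/= distrC ger0_norm ?subr_ge0 1?ltW//.
    by rewrite ltrBlDl gt_min ltrD2l gtr_pMr// invf_lt1// ltr1n orbT.
  by rewrite /U -(bigcup_seq s' K) => -[j js Kj]; exists j.
have szs' : (size s' < n)%N.
  rewrite ltnS in sn; apply: leq_trans sn.
  rewrite size_filter -(count_predC (pred1 i) s) addnC -[ltnLHS]addn0 ltn_add2l.
  by rewrite -has_count; apply/hasP; exists i => //=.
have Wcb : `|W b - W c| <= L * (b - c).
  apply: (IHn s') => // t /andP[]; rewrite le_eqVlt => /predU1P[<- _//|ct tb].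
  by apply: covr; rewrite ct.
rewrite (_ : W b - W a = (W b - W c) + (W c - W a)); last by ring.
rewrite (le_trans (ler_normD _ _))//.
by rewrite (_ : L * (b - a) = L * (b - c) + L * (c - a)) ?lerD//; ring.
Qed.

(** * Functions with continuous partial derivatives *)

Definition C1_plane (q : R * R -> R) : Prop :=
  continuous q /\
  forall j, (forall x, derivable q x (dir j)) /\ continuous (partial j q).

Lemma C1_plane_cst (c : R) : C1_plane (fun=> c).
Proof.
split; first exact: cst_continuous.
move=> j; split; first by move=> x; exact: derivable_cst.
rewrite (_ : partial j _ = fun=> 0); first exact: cst_continuous.
by apply/funext => x; exact: derive_cst.
Qed.

Lemma C1_planeD p q : C1_plane p -> C1_plane q -> C1_plane (fun x => p x + q x).
Proof.
move=> [cp dp] [cq dq]; split; first by move=> x; apply: cvgD; [exact: cp|exact: cq].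
move=> j; have [dpj cpj] := dp j; have [dqj cqj] := dq j.
split; first by move=> x; exact: derivableD.
rewrite (_ : partial j _ = fun x => partial j p x + partial j q x).
  by move=> x; apply: cvgD; [exact: cpj|exact: cqj].
by apply/funext => x; exact: deriveD.
Qed.

Lemma partialM j (p q : R * R -> R) x :
  derivable p x (dir j) -> derivable q x (dir j) ->
  partial j (fun y => p y * q y) x = p x * partial j q x + q x * partial j p x.
Proof. by move=> dp dq; exact: deriveM. Qed.

Lemma C1_planeM p q : C1_plane p -> C1_plane q -> C1_plane (fun x => p x * q x).
Proof.
move=> [cp dp] [cq dq]; split; first by move=> x; apply: cvgM; [exact: cp|exact: cq].
move=> j; have [dpj cpj] := dp j; have [dqj cqj] := dq j.
split; first by move=> x; exact: derivableM.
rewrite (_ : partial j _ = fun x => p x * partial j q x + q x * partial j p x).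
  by move=> x; apply: cvgD; apply: cvgM;
    [exact: cp|exact: cqj|exact: cq|exact: cpj].
by apply/funext => x; exact: partialM.
Qed.

Lemma C1_plane_linear (u : {linear (R * R)%type -> R}) : continuous u -> C1_plane u.
Proof.
move=> cu; have du x : forall v, is_diff x u u by move=> _; split; [exact: linear_differentiable|exact: diff_lin].
split => // j; split; first by move=> x; apply: diff_derivable; exact: linear_differentiable.
rewrite (_ : partial j _ = fun=> u (dir j)); first exact: cst_continuous.
apply/funext => x; rewrite /partial deriveE; last exact: linear_differentiable.
by rewrite diff_lin.
Qed.

Lemma C1_plane_fst : C1_plane (fun x => x.1).
Proof. by apply: (@C1_plane_linear fst) => x; exact: cvg_fst. Qed.

Lemma C1_plane_snd : C1_plane (fun x => x.2).
Proof. by apply: (@C1_plane_linear snd) => x; exact: cvg_snd. Qed.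

Lemma C1_planeX p n : C1_plane p -> C1_plane (fun x => p x ^+ n).
Proof.
move=> dp; elim: n => [|n IHn]; first exact: C1_plane_cst.
by under eq_fun do rewrite exprS; exact: C1_planeM.
Qed.

Lemma C1_plane_sum (I : Type) (s : seq I) (P : pred I) (F : I -> R * R -> R) :
  (forall i, C1_plane (F i)) -> C1_plane (fun x => \sum_(i <- s | P i) F i x).
Proof.
move=> hF; elim: s => [|i s IHs].
  by under eq_fun do rewrite big_nil; exact: C1_plane_cst.
under eq_fun do rewrite big_cons; case: (P i) => //; exact: C1_planeD.
Qed.

Lemma is_derive_line q j (x : R * R) (t : R) : derivable q x (dir j) -> 
  forall y, x = y + t *: dir j ->
  is_derive t 1 (fun v => q (y + v *: dir j)) (partial j q x).
Proof.
move=> dq y xy; have E : (fun h : R => h^-1 *: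
    (((fun v => q (y + v *: dir j)) \o shift t) (h *: 1) - q (y + t *: dir j)))
  = (fun h => h^-1 *: ((q \o shift x) (h *: dir j) - q x)).
  apply/funext => h /=; rewrite -xy; congr (_ *: (q _ - _)).
  by rewrite xy [h *: 1]mulr1 scalerDl addrCA addrA.
by split; rewrite /derivable /partial /derive E.
Qed.

Lemma C1_plane_line_lipschitz q j (x : R * R) (L t u : R) :
  C1_plane q -> t <= u ->
  (forall v, t <= v <= u -> `|partial j q (x + v *: dir j)| <= L) ->
  `|q (x + u *: dir j) - q (x + t *: dir j)| <= L * (u - t).
Proof.
move=> [_ /(_ j)[dq _]] tu hL.
pose f v := q (x + v *: dir j).
have df (v : R) : is_derive v 1 f (partial j q (x + v *: dir j)).
  exact: is_derive_line.
have [|c] := @MVT_segment _ f (fun v => partial j q (x + v *: dir j)) t u tu.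
  apply: continuous_subspaceT => v; apply: differentiable_continuous.
    by apply/derivable1_diffP; exact: ex_derive.
rewrite in_itv/= => hc; rewrite /f => ->.
by rewrite normrM ler_pM// ?hL// ger0_norm// subr_ge0.
Qed.

End Lines.

(** * Limits, translations and boxes *)

Section Tools.
Context {R : realType}.

Lemma bounded_integrable d (T : measurableType d)
    (mu : {measure set T -> \bar R}) (D : set T) (f : T -> R) (L : R) :
  measurable D -> (mu D < +oo)%E -> measurable_fun D f ->
  (forall x, D x -> `|f x| <= L) -> mu.-integrable D (EFin \o f).
Proof.
move=> mD muD mf fL; apply: measurable_bounded_integrable => //.
exists L; split; first exact: num_real.
by move=> M LM x Dx; exact: le_trans (fL _ Dx) (ltW LM).
Qed.

Lemma Rintegral_bounded_cvg d (T : measurableType d)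
    (mu : {measure set T -> \bar R}) (D : set T) (f_ : nat -> T -> R)
    (f : T -> R) (L : R) :
  measurable D -> (mu D < +oo)%E -> (forall n, measurable_fun D (f_ n)) ->
  (forall x, D x -> f_ n x @[n --> \oo] --> f x) ->
  (forall n x, D x -> `|f_ n x| <= L) ->
  \int[mu]_(x in D) f_ n x @[n --> \oo] --> \int[mu]_(x in D) f x.
Proof.
move=> mD muD mf cf fL.
have mf' := measurable_fun_cvg mf cf.
have fL' x : D x -> `|f x| <= L.
  move=> Dx; have cn : `|f_ n x| @[n --> \oo] --> `|f x|.
    by apply: cvg_norm; exact: cf.
  rewrite -(cvg_lim _ cn)//; apply: limr_le; first by apply/cvg_ex; exists `|f x|.
  by apply: nearW => n; exact: fL.
rewrite /Rintegral; apply: (@fine_cvg _ _ _ _ (fun n => \int[mu]_(x in D) (f_ n x)%:E)%E).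
have fi := bounded_integrable mD muD mf' fL'.
rewrite fineK; last by exact: integrable_fin_num.
apply: (@dominated_cvg _ _ _ mu D mD _ _ (fun=> L%:E)) => //.
- by move=> n; exact/measurable_EFinP.
- by move=> x Dx; apply: cvg_EFin; [exact: nearW|exact: cf].
- by have := @bounded_integrable _ _ mu D (fun=> L) `|L| mD muD ltac:(exact: measurable_cst) (fun _ _ => lexx _).
Qed.

(** Translation invariance is transferred from sets to functions through the
    image measure. *)
Lemma Rintegral_translate (c : R * R) (f : R * R -> R) :
  measurable_fun setT f -> leb2.-integrable setT (EFin \o (fun x => f (x + c))) ->
  \int[leb2]_x f (x + c) = \int[leb2]_x f x.
Proof.
move=> mf fi; rewrite /Rintegral; congr fine.
have mT : measurable_fun [set: measurableTypeR R * measurableTypeR R]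
    ((fun x : R * R => x + c) : measurableTypeR R * measurableTypeR R ->
       measurableTypeR R * measurableTypeR R).
  apply: measurable_fun_pair.
    by apply: measurable_funD => //; exact: measurable_fst.
  by apply: measurable_funD => //; exact: measurable_snd.
have mf' : measurable_fun [set: measurableTypeR R * measurableTypeR R] (EFin \o f).
  exact/measurable_EFinP.
have := @integral_pushforward _ _ _ _ R _ mT leb2 setT (EFin \o f) mf'.
rewrite preimage_setT => /(_ fi (@measurableT _ _)) <-.
pose mu2 := measure_function_pushforward__canonical__measure_function_Measure leb2 mT.
rewrite (@eq_measure_integral _ _ _ setT leb2 mu2)//.
by move=> A mA _; exact: lebesgue2_translate.
Qed.

Definition box (B : R) : set (R * R) := `[- B, B]%classic `*` `[- B, B]%classic.

Lemma continuous_box_bounded (q : R * R -> R) B : continuous q ->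
  exists L, forall x, box B x -> `|q x| <= L.
Proof.
move=> cq; have cB : compact (box B).
  by apply: compact_setX; exact: segment_compact.
have [M [_ hM]] : bounded_set (q @` box B).
  by apply/compact_bounded/continuous_compact => //; exact: continuous_subspaceT.
exists (M + 1) => x Bx; apply: hM; first by rewrite ltrDl.
by exists x.
Qed.

Lemma bounded_closure_box (A : set (R * R)) : bounded_set A ->
  exists B, closure A `<=` box B.
Proof.
move=> [M [_ /(_ (M + 1))]]; rewrite ltrDl => /(_ ltr01) hM.
exists (M + 1); rewrite (closure_id (box _)).1; last first.
  apply: compact_closed; first exact: norm_hausdorff.
  by apply: compact_setX; exact: segment_compact.
apply: closure_subset => x /hM /=; rewrite prod_normE ge_max => /andP[h1 h2].
by split; rewrite /= in_itv/= -ler_norml.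
Qed.

Lemma box_segment B (x : R * R) j (t u v : R) : t <= v <= u ->
  box B (x + t *: dir j) -> box B (x + u *: dir j) -> box B (x + v *: dir j).
Proof.
move=> /andP[tv vu]; rewrite /box/= /dir /GRing.scale/=; case: ifP => _ /=;
  rewrite ?in_itv/= ?mulr1 ?mulr0 ?addr0 => -[/andP[a1 a2] /andP[b1 b2]]
  [/andP[c1 c2] /andP[d1 d2]]; split; apply/andP; split; lra.
Qed.

Lemma box_finite B : (leb2 (box B) < +oo)%E.
Proof.
rewrite product_measure1E; try exact: measurable_itv.
by rewrite /= lebesgue_measure_itv/=; case: ifP => _; rewrite -?EFinD -?EFinM ?mul0e ltry.
Qed.

Lemma bary_continuous i : continuous (@bary R i).
Proof.
move=> x; rewrite /bary; case: i => -[|[|[|//]]] _ /=.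
- by apply: cvgB; [apply: cvgB; [exact: cvg_cst|exact: cvg_fst]|exact: cvg_snd].
- exact: cvg_fst.
- exact: cvg_snd.
Qed.

Lemma ref_triangle_closed : closed (@ref_triangle R).
Proof.
rewrite (_ : ref_triangle = \bigcap_i (bary i @^-1` [set t : R | 0 <= t])).
  apply: closed_bigI => i _; apply: (continuous_closedP _).1; last exact: closed_ge.
  exact: bary_continuous.
by apply/seteqP; split => [x hx i _|x hx i]; [exact: hx|exact: hx].
Qed.

End Tools.

(** * The interior of a mesh *)

Section Mesh.
Context {R : realType}.
Variables (omega : set (R * R)) (m : nat) (G : 'I_m -> R * R -> R * R).
Hypotheses (oomega : open omega) (bomega : bounded_set omega).
Hypothesis conf : conforming_triangulation omega G.

Definition mesh_interior : set (R * R) :=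
  omega `&` \bigcup_i (elt G i)°.

Lemma mesh_interior_open : open mesh_interior.
Proof.
by apply: openI => //; apply: bigcup_open => i _; exact: open_interior.
Qed.

Lemma elt_closed i : closed (elt G i).
Proof.
have [/(_ i)[_ [H cH [GH HG]]] _ _ _] := conf.
rewrite /elt (_ : _ @` _ = H @^-1` ref_triangle).
  by apply: (continuous_closedP _).1 => //; exact: ref_triangle_closed.
by apply/seteqP; split => [_ [y hy <-]|x hx] /=; [rewrite GH|exists (H x)].
Qed.

(** The barycentric coordinates of the inverse parametrization are continuous,
    so they remain positive near an image of an interior point. *)
Lemma elt_interior i x : ref_triangle x -> (forall a, ~ ref_edge a x) ->
  (elt G i)° (G i x).
Proof.
have [/(_ i)[_ [H cH [GH HG]]] _ _ _] := conf.
move=> tx ex.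
have pos a : 0 < bary a x.
  by rewrite lt_neqAle tx andbT; apply/eqP => h; apply: (ex a); split.
have : \forall y \near G i x, forall a, 0 < bary a (H y).
  apply: (@filter_forall _ 'I_3 (fun a y => 0 < bary a (H y)) (nbhs (G i x))) => a.
  have cb : bary a (H y) @[y --> G i x] --> bary a (H (G i x)).
    by apply: continuous_cvg; [exact: bary_continuous|exact: cH].
  by apply: (cvgr_gt _ cb); rewrite GH.
apply: filterS => y hy; exists (H y) => // a; exact/ltW.
Qed.

(** A point of [omega] is inside an element unless it lies on an edge; the edges
    on the boundary do not meet the open set [omega], and the others are
    segments. *)
Lemma mesh_interior_null : exists N : set (R * R),
  [/\ measurable N, leb2 N = 0%E & omega `\` N `<=` mesh_interior].
Proof.
have hE (e : 'I_m * 'I_3) : exists N : set (R * R), [/\ measurable N, leb2 N = 0%E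
    & G e.1 @` ref_edge e.2 `&` omega `<=` N].
  have [_ _ /(_ e.1 e.2) he _] := conf.
  case: he => [he|[p [q ->]]]; last first.
    by have [N [? ? hN]] := segment_null p q; exists N; split => // x [/hN].
  exists set0; split => // x [/he[_ nx] ox]; apply: nx.
  by move: oomega; rewrite openE; exact.
have [N hN] := choice hE.
exists (\big[setU/set0]_e N e).
have [mN N0] : measurable (\big[setU/set0]_e N e) /\
    leb2 (\big[setU/set0]_e N e) = 0%E.
  elim/big_ind : _ => [|A B [mA A0] [mB B0]|e _]; first by rewrite measure0.
    by split; [exact: measurableU|rewrite null_set_setU].
  by have [] := hN e.
split => // x [ox xN]; split => //.
have : closure omega x by exact: subset_closure.
have [_ <- _ _] := conf; move=> [i _ [y ty yx]].
exists i => //; rewrite -yx; apply: elt_interior => // a ea; apply: xN.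
rewrite (bigD1 (i, a))//=; left; have [_ _] := hN (i, a); apply; split => //=.
by exists y.
Qed.

(** This holds for every integrand, measurable or not, and so for the derivatives
    of finite element functions, whose values on the edges are arbitrary. *)
Lemma Rintegral_mesh_interior (f : R * R -> R) :
  \int[leb2]_(x in omega) f x = \int[leb2]_(x in mesh_interior) f x.
Proof.
have [N [mN N0 hN]] := mesh_interior_null.
have E (D : set (R * R)) : \int[leb2]_(x in D) f x = \int[leb2]_(x in D `\` N) f x.
  exact: Rintegral_setD_null.
rewrite E [RHS]E.
congr (Rintegral _ _ _); apply/seteqP; split => x [xo xN]; split => //; last by case: xo.
exact: hN.
Qed.

End Mesh.

(** * Local regularity *)

Section Local.
Context {R : realType}.

Definition locally_C1 (w : R * R -> R) (x : R * R) : Prop :=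
  exists2 q, C1_plane q & \forall y \near x, w y = q y.

Lemma locally_C1_continuous w x : locally_C1 w x -> {for x, continuous w}.
Proof.
move=> [q [cq _] wq]; rewrite /prop_for /continuous_at (nbhs_singleton wq).
by apply: cvg_trans (cq x); apply: near_eq_cvg; apply: filterS wq => y ->.
Qed.

Lemma locally_C1_derivable w x j : locally_C1 w x -> derivable w x (dir j).
Proof.
move=> [q [_ /(_ j)[dq _]] wq]; apply: near_eq_derivable (dq x).
by apply: filterS wq => y ->.
Qed.

Lemma locally_C1_partial w x j : locally_C1 w x ->
  {for x, continuous (partial j w)}.
Proof.
move=> [q [_ /(_ j)[_ cq]] wq].
have E : \forall y \near x, partial j w y = partial j q y.
  by apply: filterS (near_join wq) => y wqy; exact: near_eq_derive.
rewrite /prop_for /continuous_at (nbhs_singleton E).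
by apply: cvg_trans (cq x); apply: near_eq_cvg; apply: filterS E => y ->.
Qed.

End Local.

(** * The divergence theorem for piecewise smooth functions *)

Section Piecewise.
Context {R : realType}.
Variables (omega : set (R * R)) (m : nat) (G : 'I_m -> R * R -> R * R).
Hypotheses (oomega : open omega) (bomega : bounded_set omega).
Hypothesis conf : conforming_triangulation omega G.
Local Notation reg := (mesh_interior omega G).

(** The restrictions to elements must extend to the whole plane, so that the
    mean value theorem applies on segments leaving a nonconvex element. *)
Definition piecewise_C1 (w : R * R -> R) : Prop :=
  exists p : 'I_m -> R * R -> R,
    forall i, C1_plane (p i) /\ forall x, elt G i x -> w x = p i x.

Lemma piecewise_C1M w z : piecewise_C1 w -> piecewise_C1 z ->
  piecewise_C1 (fun x => w x * z x).
Proof.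
move=> [p hp] [q hq]; exists (fun i x => p i x * q i x) => i.
have [dp wp] := hp i; have [dq zq] := hq i.
by split; [exact: C1_planeM|move=> x ex; rewrite wp ?zq].
Qed.

Lemma piecewise_C1_local w x : piecewise_C1 w -> reg x -> locally_C1 w x.
Proof.
move=> [p hp] [_ [i _ ex]]; have [dp wp] := hp i; exists (p i) => //.
by apply: filterS ex => y; exact: wp.
Qed.

Let elt_closure i : elt G i `<=` closure omega.
Proof. by have [_ <- _ _] := conf; exact: bigcup_sup. Qed.

Lemma common_box_bound (p : 'I_m -> R * R -> R) b : (forall i, continuous (p i)) ->
  exists2 L : R, 0 <= L & forall i x, box b x -> `|p i x| <= L.
Proof.
move=> cp; have /choice[L hL] : forall i, exists l, forall x, box b x -> `|p i x| <= l.
  by move=> i; exact: continuous_box_bounded.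
exists (\sum_i `|L i|); first exact: sumr_ge0.
move=> i x bx; apply: le_trans (hL i x bx) _; apply: le_trans (ler_norm _) _.
by rewrite (bigD1 i)//= lerDl sumr_ge0.
Qed.

Lemma piecewise_C1_bounded w : piecewise_C1 w ->
  exists B, forall x, reg x -> `|w x| <= B.
Proof.
move=> [p hp]; have [b hb] := bounded_closure_box bomega.
have [|L _ hL] := @common_box_bound p b; first by move=> i; have [[]] := hp i.
exists L => x [_ [i _ /interior_subset ex]]; have [_ ->//] := hp i.
by apply/hL/hb/(elt_closure ex).
Qed.

Lemma piecewise_C1_partial_bounded w j : piecewise_C1 w ->
  exists B, forall x, reg x -> `|partial j w x| <= B.
Proof.
move=> [p hp]; have [b hb] := bounded_closure_box bomega.
have [|L _ hL] := @common_box_bound (fun i => partial j (p i)) b.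
  by move=> i; have [[_ /(_ j)[_ cpj]] _] := hp i.
exists L => x [_ [i _ ex]]; have [_ wp] := hp i.
rewrite (_ : partial j w x = partial j (p i) x).
  by apply: hL; apply: hb; apply: (@elt_closure i); exact: interior_subset.
by apply: near_eq_derive; apply: filterS ex => y; exact: wp.
Qed.

Definition zero_ext (w : R * R -> R) : R * R -> R :=
  fun x => if x \in omega then w x else 0.

Lemma zero_ext_in w x : omega x -> zero_ext w x = w x.
Proof. by move=> ox; rewrite /zero_ext mem_set. Qed.

Lemma zero_ext_out w x : ~ omega x -> zero_ext w x = 0.
Proof. by move=> ox; rewrite /zero_ext memNset. Qed.

Section ZeroTrace.
Variable w : R * R -> R.
Hypotheses (pw : piecewise_C1 w) (w0 : forall x, bd omega x -> w x = 0).

(** Each line is covered by the traces of the elements and of the complement of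
    [omega].  The zero boundary values make the extension agree with the local
    representative on the whole of each element, boundary points included. *)
Lemma zero_ext_lipschitz j : exists2 L, 0 <= L &
  forall x t, `|zero_ext w (x + t *: dir j) - zero_ext w x| <= L * `|t|.
Proof.
have [p hp] := pw; have [b hb] := bounded_closure_box bomega.
have [|L L0 hL] := @common_box_bound (fun i => partial j (p i)) b.
  by move=> i; have [[_ /(_ j)[_ cpj]] _] := hp i.
have wE i x : elt G i x -> zero_ext w x = p i x.
  move=> ex; have [_ wp] := hp i; have [ox|nox] := pselect (omega x).
    by rewrite zero_ext_in// wp.
  rewrite zero_ext_out// -wp// w0//; split; first exact: elt_closure ex.
  by move=> /interior_subset.
exists L => //.
suff H x t u : t <= u ->
    `|zero_ext w (x + u *: dir j) - zero_ext w (x + t *: dir j)| <= L * (u - t).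
  move=> x t; have [t0|t0] := leP 0 t.
    by have := H x 0 t t0; rewrite scale0r addr0 subr0 (ger0_norm t0).
  have := H x t 0 (ltW t0).
  by rewrite scale0r addr0 sub0r distrC (ltr0_norm t0).
move=> tu; pose K (o : option 'I_m) : set R :=
  [set v | if o is Some i then elt G i (x + v *: dir j) else ~ omega (x + v *: dir j)].
have cl : continuous (fun v : R => x + v *: dir j).
  by move=> v; apply: cvgD; [exact: cvg_cst|apply: cvgZr_tmp; exact: cvg_id].
apply: (@closed_cover_lipschitz _ _ (enum {: option 'I_m}) K
  (fun v => zero_ext w (x + v *: dir j))) => //.
- move=> [i|]; rewrite /K/=.
    by apply: ((continuous_closedP _).1 cl (elt G i)); exact: (elt_closed conf).
  by apply: ((continuous_closedP _).1 cl (~` omega)); exact: open_closedC.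
- move=> [i|] v1 v2; rewrite /K/= => h1 h2 v12.
    have [dp _] := hp i; rewrite !(wE i)//; apply: C1_plane_line_lipschitz => // v hv.
    by apply: hL; apply: box_segment hv _ _; apply/hb/elt_closure; [exact: h1|exact: h2].
  by rewrite !zero_ext_out// subrr normr0 mulr_ge0// subr_ge0.
- move=> v _; have [ox|] := pselect (omega (x + v *: dir j)); last first.
    by exists None; rewrite ?mem_enum.
  have [_ cov _ _] := conf; have := subset_closure ox; rewrite -cov => -[i _ ei].
  by exists (Some i); rewrite ?mem_enum.
Qed.

(** Lipschitz bounds in the two coordinate directions add up. *)
Lemma zero_ext_continuous : continuous (zero_ext w).
Proof.
have [L0 L00 h0] := zero_ext_lipschitz 0; have [L1 L10 h1] := zero_ext_lipschitz 1.
move=> x; pose g y := L1 * `|y.2 - x.2| + L0 * `|y.1 - x.1| : R.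
have gx : g y @[y --> x] --> (0 : R).
  rewrite [X in _ --> X](_ : 0 = g x); last by rewrite /g !subrr normr0 !mulr0 addr0.
  by apply: cvgD; apply: cvgM; (try exact: cvg_cst); apply: cvg_norm; apply: cvgB;
    (try exact: cvg_cst); [exact: cvg_snd|exact: cvg_fst].
apply/cvgrPdist_lt => e e0; near=> y.
apply: (@le_lt_trans _ _ (g y)); last by near: y; exact: (cvgr_lt _ gx).
rewrite distrC; pose z := x + (y.1 - x.1) *: dir 0.
have yE : y = z + (y.2 - x.2) *: dir 1.
  have d0 : dir 0 = (1, 0) :> R * R by [].
  have d1 : dir 1 = (0, 1) :> R * R by [].
  rewrite /z d0 d1 [LHS]surjective_pairing /GRing.scale/=.
  by apply/eqP/andP; split; apply/eqP => /=; rewrite /GRing.scale/=; ring.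
rewrite (_ : _ - _ = (zero_ext w y - zero_ext w z) + (zero_ext w z - zero_ext w x)); last by ring.
rewrite (le_trans (ler_normD _ _))// lerD//; last exact: h0.
by rewrite {1}yE; exact: h1.
Unshelve. all: by end_near. Qed.

Lemma mesh_interior_measurable : measurable reg.
Proof. by apply: open_measurable2; exact: mesh_interior_open. Qed.

Lemma domain_measurable : measurable omega.
Proof. exact: open_measurable2. Qed.

Lemma domain_finite : (leb2 omega < +oo)%E.
Proof.
have [b hb] := bounded_closure_box bomega.
apply: le_lt_trans (box_finite b); apply: le_measure; rewrite ?inE.
- exact: domain_measurable.
- by apply: measurableX; exact: measurable_itv.
- by move=> x /subset_closure /hb.
Qed.

Lemma mesh_interior_finite : (leb2 reg < +oo)%E.
Proof.
apply: le_lt_trans domain_finite; apply: le_measure; rewrite ?inE.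
- exact: mesh_interior_measurable.
- exact: domain_measurable.
- by move=> x [].
Qed.

Lemma Rintegral_domain_indic (f : R * R -> R) :
  \int[leb2]_(x in omega) f x = \int[leb2]_x (\1_omega x * f x).
Proof.
rewrite Rintegral_mkcond; apply: eq_Rintegral => x _.
by rewrite patchE indicE; case: ifP => _; rewrite ?mul1r ?mul0r.
Qed.

(** The divergence theorem with zero boundary values.  With [h = 1 / (n + 1)] the
    difference quotients [u n] converge boundedly to the partial derivative, and
    by translation invariance they have the same integral over [omega] as
    [g n y = (1_omega (y - h e) - 1) z y / h].  This is bounded, because
    [z (y - h e) = 0] when [y - h e] is outside [omega], and it vanishes for
    large [n] because [omega] is open. *)
Theorem integral_partial_eq0 j : \int[leb2]_(x in omega) partial j w x = 0.
Proof.
have [L L0 hL] := zero_ext_lipschitz j; set z := zero_ext w in hL.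
have cz : continuous z := zero_ext_continuous.
pose h (n : nat) : R := harmonic n; pose e : R * R := dir j.
have h0 n : 0 < h n by exact: harmonic_gt0.
have [b hb] := bounded_closure_box bomega.
have [B hB] := continuous_box_bounded b cz.
have zB x : `|z x| <= `|B|.
  have [ox|nox] := pselect (omega x).
    by apply: le_trans (ler_norm _); apply/hB/hb/subset_closure.
  by rewrite /z zero_ext_out// normr0.
have mo := domain_measurable; have fo := domain_finite.
have csh (c : R * R) : continuous (fun x : R * R => x + c).
  by move=> x; apply: cvgD; [exact: cvg_id|exact: cvg_cst].
have mcont (D : set (R * R)) (f : R * R -> R) : measurable D -> continuous f ->
    measurable_fun D f.
  move=> mD cf; apply: (measurable_funS measurableT) => //.
  by apply: continuous_measurable2 => [|x _]; [exact: openT|exact: cf].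
have czc (c : R * R) : continuous (fun x : R * R => z (x + c)).
  by move=> x; apply: continuous_cvg; [exact: cz|exact: csh].
have mind (c : R * R) : measurable_fun setT (fun y : R * R => \1_omega (y - c) : R).
  rewrite (_ : (fun _ => _) = \1_((fun y : R * R => y - c) @^-1` omega)).
    apply: measurable_indic; apply: open_measurable2.
    by apply: open_comp => // x _; exact: csh.
  by apply/funext => y; rewrite !indicE.
pose u n x := (h n)^-1 * (z (x + h n *: e) - z x).
have cvg_u : \int[leb2]_(x in omega) u n x @[n --> \oo] -->
    \int[leb2]_(x in omega) partial j w x.
  rewrite (Rintegral_mesh_interior oomega conf).
  under eq_fun do rewrite (Rintegral_mesh_interior oomega conf).
  apply: (@Rintegral_bounded_cvg _ _ _ _ _ _ _ L).
  - exact: mesh_interior_measurable.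
  - exact: mesh_interior_finite.
  - move=> n; apply: mcont; first exact: mesh_interior_measurable.
    move=> x; apply: cvgM; first exact: cvg_cst.
    by apply: cvgB; [exact: czc|exact: cz].
  - move=> x rx; have ox : omega x by case: rx.
    have wz : \forall y \near x, w y = z y.
      have : nbhs x omega by move: oomega; rewrite openE; exact.
      by apply: filterS => y oy; rewrite /z zero_ext_in.
    have dz : derivable z x e.
      by apply: near_eq_derivable wz _; apply: locally_C1_derivable; exact: piecewise_C1_local.
    rewrite /partial (near_eq_derive _ wz).
    have lim_h : h n @[n --> \oo] --> (0 : R) by exact: cvg_harmonic.
    have hn0 n : h n != 0 by rewrite gt_eqF.
    have := (cvgr_dnbhsP _ _ _).1 (dz : _ --> 'D_e z x) h (conj hn0 lim_h).
    have -> : (fun n => u n x) = (fun n => (h n)^-1 *: ((z \o shift x) (h n *: e) - z x)).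
      by apply/funext => n; rewrite /u /= [x + _]addrC.
    by [].
  - move=> n x _; rewrite /u normrM normfV (gtr0_norm (h0 n)) ler_pdivrMl//.
    by rewrite mulrC; have := hL x (h n); rewrite (gtr0_norm (h0 n)).
pose g n y := (h n)^-1 * ((\1_omega (y - h n *: e) - 1) * z y).
have cvg_g : \int[leb2]_(x in omega) g n x @[n --> \oo] --> (0 : R).
  rewrite [X in _ --> X](_ : 0 = \int[leb2]_(x in omega) 0); last first.
    by rewrite Rintegral_cst// mul0r.
  apply: (@Rintegral_bounded_cvg _ _ _ _ _ _ _ L) => //.
  - move=> n; apply: (measurable_funS measurableT) => //.
    apply: measurable_funM; first exact: measurable_cst.
    apply: measurable_funM; last exact: mcont.
    by apply: measurable_funB => //; exact: mind.
  - move=> y oy; apply: cvg_near_cst.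
    have lim_h : y - h n *: e @[n --> \oo] --> y.
      rewrite -[X in _ --> X]subr0 -(scale0r e); apply: cvgB; first exact: cvg_cst.
      by apply: cvgZr_tmp; exact: cvg_harmonic.
    have : nbhs y omega by move: oomega; rewrite openE; exact.
    move=> /lim_h hn; near=> n; have on : omega (y - h n *: e) by near: n; exact: hn.
    by rewrite /g indicE mem_set// subrr mul0r mulr0.
  - move=> n y oy; rewrite /g normrM normfV (gtr0_norm (h0 n)) ler_pdivrMl//.
    rewrite indicE; have [_|] := boolP (_ \in omega).
      by rewrite subrr mul0r normr0 mulr_ge0// ltW.
    rewrite notin_setE => no; rewrite sub0r mulN1r normrN.
    have := hL (y - h n *: e) (h n).
    by rewrite subrK /z (zero_ext_out _ no) subr0 mulrC (gtr0_norm (h0 n)).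
have bint (f : R * R -> R) M : measurable_fun setT f -> (forall x, `|f x| <= M) ->
    leb2.-integrable omega (EFin \o f).
  move=> mf fM; apply: (@bounded_integrable _ _ _ _ _ _ M) => //.
  exact: measurable_funS mf.
have ug n : \int[leb2]_(x in omega) u n x = \int[leb2]_(x in omega) g n x.
  pose c := h n *: e; pose F y := \1_omega (y - c) * z y : R.
  have mF : measurable_fun setT F.
    by apply: measurable_funM; [exact: mind|exact: mcont].
  have Fb x : `|F x| <= `|B|.
    rewrite /F indicE normrM; case: (_ \in _).
      by rewrite normr1 mul1r.
    by rewrite normr0 mul0r.
  have iz := bint z _ (mcont _ _ measurableT cz) zB.
  have izc := bint _ _ (mcont _ _ measurableT (czc c)) (fun x => zB (x + c)).
  have iF := bint F _ mF Fb.
  have E : \int[leb2]_(x in omega) z (x + c) = \int[leb2]_(x in omega) F x.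
    rewrite Rintegral_domain_indic.
    transitivity (\int[leb2]_x F (x + c)).
      by apply: eq_Rintegral => x _; rewrite /F addrK.
    rewrite Rintegral_translate//; last first.
      rewrite (_ : _ \o _ = (fun x => (z (x + c))%:E) \_ omega).
        exact: (iffLR (@integrable_mkcond _ _ _ leb2 omega (fun x => (z (x + c))%:E) mo)).  
      apply/funext => x /=; rewrite patchE /F addrK indicE.
      by case: ifP => _; rewrite ?mul1r ?mul0r.
    rewrite Rintegral_domain_indic; apply: eq_Rintegral => x _.
    rewrite [\1_omega x]indicE; case: (boolP (x \in omega)) => [_|]; first by rewrite mul1r.
    by rewrite notin_setE => nox; rewrite /F /z zero_ext_out// !mulr0.
  rewrite /u /g RintegralZl//; last exact: (integrableB _ izc iz).
  under [RHS]eq_Rintegral do rewrite mulrBl mul1r -/(F _).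
  rewrite [RHS]RintegralZl//; last exact: (integrableB _ iF iz).
  by rewrite !RintegralB// E.
have : \int[leb2]_(x in omega) u n x @[n --> \oo] --> (0 : R).
  by under eq_fun do rewrite ug.
by move=> /(cvg_unique _ cvg_u); apply.
Unshelve. all: by end_near.
Qed.

End ZeroTrace.
End Piecewise.

(** * Square integrable fields and Young's inequality *)

Section Fields.
Context {R : realType}.
Variable D : set (R * R).
Hypotheses (oD : open D) (fD : (leb2 D < +oo)%E).
Let mD : measurable (D : set (measurableTypeR R * measurableTypeR R)).
Proof. exact: open_measurable2. Qed.

(** Continuity at the points of [D] only: the partial derivatives of a finite
    element function jump across edges. *)
Definition tame (f : R * R -> R) : Prop :=
  (forall x, D x -> {for x, continuous f}) /\
  exists B, forall x, D x -> `|f x| <= B.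

Lemma tame_cst (c : R) : tame (fun=> c).
Proof. by split=> [x _|]; [exact: cst_continuous|exists `|c|]. Qed.

Lemma tameD f g : tame f -> tame g -> tame (fun x => f x + g x).
Proof.
move=> [cf [B hB]] [cg [C hC]]; split.
  by move=> x Dx; apply: cvgD; [exact: cf|exact: cg].
exists (B + C) => x Dx; apply: le_trans (ler_normD _ _) _.
by rewrite lerD ?hB ?hC.
Qed.

Lemma tameM f g : tame f -> tame g -> tame (fun x => f x * g x).
Proof.
move=> [cf [B hB]] [cg [C hC]]; split.
  by move=> x Dx; apply: cvgM; [exact: cf|exact: cg].
by exists (B * C) => x Dx; rewrite normrM ler_pM ?hB ?hC.
Qed.

Lemma tameB f g : tame f -> tame g -> tame (fun x => f x - g x).
Proof.
move=> tf tg; under eq_fun do rewrite -mulN1r.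
by apply: tameD => //; apply: tameM => //; exact: tame_cst.
Qed.

Lemma tame_sum (I : Type) (s : seq I) (F : I -> R * R -> R) :
  (forall i, tame (F i)) -> tame (fun x => \sum_(i <- s) F i x).
Proof.
move=> hF; elim: s => [|i s IHs].
  by under eq_fun do rewrite big_nil; exact: tame_cst.
by under eq_fun do rewrite big_cons; exact: tameD.
Qed.

Lemma tame_comp (g : R -> R) f : continuous g -> tame f -> tame (fun x => g (f x)).
Proof.
move=> cg [cf [B hB]]; split.
  by move=> x Dx; apply: continuous_comp; [exact: cf|exact: cg].
have [M [_ hM]] : bounded_set (g @` `[- B, B]).
  apply/compact_bounded/continuous_compact; first exact: continuous_subspaceT.
  exact: segment_compact.
exists (M + 1) => x Dx; apply: hM; first by rewrite ltrDl.
by exists (f x) => //=; rewrite in_itv/= -ler_norml hB.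
Qed.

Lemma tame_measurable f : tame f -> measurable_fun D f.
Proof. by move=> [cf _]; exact: continuous_measurable2. Qed.

Lemma tame_integrable f : tame f -> leb2.-integrable D (EFin \o f).
Proof.
move=> tf; have [_ [B hB]] := tf.
by apply: (@bounded_integrable _ _ _ _ _ _ B) => //; exact: tame_measurable.
Qed.

Lemma tame_L2 f : tame f -> L2 D f.
Proof.
move=> tf; split; first exact: tame_measurable.
by apply: (@tame_integrable (fun x => f x * f x)); exact: tameM.
Qed.

Lemma L2_integrableM f g : L2 D f -> L2 D g ->
  leb2.-integrable D (EFin \o (fun x => f x * g x)).
Proof.
move=> [mf f2] [mg g2].
apply: (@le_integrable _ _ _ _ _ mD _ (fun x => ((f x) ^+ 2)%:E + ((g x) ^+ 2)%:E)%E).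
- by apply/measurable_EFinP; exact: measurable_funM.
- move=> x _; rewrite /= lee_fin normrM [leRHS]ger0_norm ?addr_ge0 ?sqr_ge0//.
  rewrite -[f x ^+ 2]real_normK ?num_real// -[g x ^+ 2]real_normK ?num_real//.
  nra.
- exact: integrableD.
Qed.

Lemma L2D f g : L2 D f -> L2 D g -> L2 D (fun x => f x + g x).
Proof.
move=> lf lg; have [mf f2] := lf; have [mg g2] := lg; split.
  exact: measurable_funD.
have fg := L2_integrableM lf lg.
rewrite (_ : (fun _ => _) = (fun x => ((f x) ^+ 2)%:E + 2%:E * (f x * g x)%:E +
    ((g x) ^+ 2)%:E)%E).
  by apply: integrableD => //; apply: integrableD => //; exact: integrableZl.
by apply/funext => x; rewrite -EFinM -!EFinD; congr EFin; ring.
Qed.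

Lemma L2M f g : tame f -> L2 D g -> L2 D (fun x => f x * g x).
Proof.
move=> tf [mg g2]; have [_ [B hB]] := tf; have mf := tame_measurable tf.
split; first exact: measurable_funM.
apply: (@le_integrable _ _ _ _ _ mD _ (fun x => (B ^+ 2)%:E * ((g x) ^+ 2)%:E)%E).
- by apply/measurable_EFinP; apply: measurable_funX; exact: measurable_funM.
- move=> x Dx; rewrite /= lee_fin exprMn normrM [leRHS]normrM ler_wpM2r// !normrX lerXn2r ?nnegrE//.
  exact: le_trans (hB x Dx) (ler_norm _).
- exact: integrableZl.
Qed.

Lemma L2Z c f : L2 D f -> L2 D (fun x => c * f x).
Proof. by apply: L2M; exact: tame_cst. Qed.

Lemma ip_sym f g : ip D f g = ip D g f.
Proof. by apply: eq_Rintegral => x _; rewrite mulrC. Qed.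

Lemma ipZl c f g : L2 D f -> L2 D g -> ip D (fun x => c * f x) g = c * ip D f g.
Proof.
move=> lf lg; rewrite /ip -RintegralZl//; last exact: L2_integrableM.
by apply: eq_Rintegral => x _; rewrite mulrA.
Qed.

Lemma ipDl f g h : L2 D f -> L2 D g -> L2 D h ->
  ip D (fun x => f x + g x) h = ip D f h + ip D g h.
Proof.
move=> lf lg lh; rewrite /ip -RintegralD//; try exact: L2_integrableM.
by apply: eq_Rintegral => x _; rewrite mulrDl.
Qed.

Lemma sqnormZ c f : L2 D f -> sqnorm D (fun x => c * f x) = c ^+ 2 * sqnorm D f.
Proof.
move=> lf; have lcf := L2Z c lf.
by rewrite /sqnorm ipZl// ip_sym ipZl// mulrA expr2.
Qed.

(** The difference of the two sides is the integral of
    [e (f - g / (2 e))^2]. *)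
Lemma ip_young e f g : 0 < e -> L2 D f -> L2 D g ->
  ip D f g <= e * sqnorm D f + (4 * e)^-1 * sqnorm D g.
Proof.
move=> e0 lf lg; rewrite /sqnorm /ip -!RintegralZl//; try exact: L2_integrableM.
have iff := L2_integrableM lf lf; have igg := L2_integrableM lg lg.
have h1 : leb2.-integrable D (EFin \o (fun x => e * (f x * f x))).
  exact: (integrableZl mD e iff).
have h2 : leb2.-integrable D (EFin \o (fun x => (4 * e)^-1 * (g x * g x))).
  exact: (integrableZl mD _ igg).
rewrite -RintegralD//; apply: le_Rintegral => //; first exact: L2_integrableM.
  exact: (integrableD mD h1 h2).
move=> x _; rewrite -subr_ge0.
rewrite (_ : _ - _ = e * (f x - (2 * e)^-1 * g x) ^+ 2).
  by rewrite mulr_ge0 ?sqr_ge0// ltW.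
by field; rewrite gt_eqF.
Qed.

Lemma ip_ge0 f g : (forall x, D x -> 0 <= f x * g x) -> 0 <= ip D f g.
Proof. by move=> h; exact: Rintegral_ge0. Qed.

Lemma Rintegral_sum (I : Type) (s : seq I) (F : I -> R * R -> R) :
  (forall i, leb2.-integrable D (EFin \o F i)) ->
  leb2.-integrable D (EFin \o (fun x => \sum_(i <- s) F i x)) /\
  \int[leb2]_(x in D) (\sum_(i <- s) F i x) = \sum_(i <- s) \int[leb2]_(x in D) F i x.
Proof.
move=> iF; elim: s => [|i s [IHi IHs]].
  under eq_fun do rewrite big_nil.
  by rewrite big_nil Rintegral_cst// mul0r; split => //; exact: tame_integrable (tame_cst 0).
under eq_fun do rewrite big_cons.
rewrite big_cons; split; first exact: (integrableD mD (iF i) IHi).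
by rewrite RintegralD// IHs.
Qed.

Lemma frobE (m n : nat) (A B : 'M[R]_(m, n)) :
  frob A B = \sum_i \sum_j A i j * B i j.
Proof.
rewrite /frob /mxtrace exchange_big; apply: eq_bigr => j _.
by rewrite mxE; apply: eq_bigr => i _; rewrite mxE.
Qed.

Definition L2mx (m n : nat) (A : R * R -> 'M[R]_(m, n)) : Prop :=
  forall i j, L2 D (fun x => A x i j).

Definition tamemx (m n : nat) (A : R * R -> 'M[R]_(m, n)) : Prop :=
  forall i j, tame (fun x => A x i j).

Section Matrix.
Variables m n : nat.
Implicit Types A B C : R * R -> 'M[R]_(m, n).

Lemma tame_L2mx A : tamemx A -> L2mx A.
Proof. by move=> tA i j; exact: tame_L2. Qed.

Lemma tame_frob A B : tamemx A -> tamemx B -> tame (fun x => frob (A x) (B x)).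
Proof.
move=> tA tB; under eq_fun do rewrite frobE.
by do 2 (apply: tame_sum => ?); exact: tameM.
Qed.

Lemma tamemxZ f A : tame f -> tamemx A -> tamemx (fun x => f x *: A x).
Proof. by move=> tf tA i j; under eq_fun do rewrite mxE; exact: tameM. Qed.

Lemma L2mxZ f A : tame f -> L2mx A -> L2mx (fun x => f x *: A x).
Proof. by move=> tf tA i j; under eq_fun do rewrite mxE; exact: L2M. Qed.

Lemma L2mxD A B : L2mx A -> L2mx B -> L2mx (fun x => A x + B x).
Proof. by move=> tA tB i j; under eq_fun do rewrite mxE; exact: L2D. Qed.

Lemma mip_sym A B : mip D A B = mip D B A.
Proof.
apply: eq_Rintegral => x _; rewrite !frobE.
by apply: eq_bigr => i _; apply: eq_bigr => j _; rewrite mulrC.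
Qed.

Lemma mip_sum A B : L2mx A -> L2mx B ->
  mip D A B = \sum_i \sum_j ip D (fun x => A x i j) (fun x => B x i j).
Proof.
move=> lA lB; rewrite /mip.
have iA i j : leb2.-integrable D (EFin \o (fun x => A x i j * B x i j)).
  exact: L2_integrableM.
under eq_Rintegral do rewrite frobE.
have [_ ->] := Rintegral_sum (index_enum 'I_m)
  (fun i => (Rintegral_sum (index_enum 'I_n) (iA i)).1).
by apply: eq_bigr => i _; have [_ ->] := Rintegral_sum (index_enum 'I_n) (iA i).
Qed.

Lemma mipZl c A B : L2mx A -> L2mx B ->
  mip D (fun x => c *: A x) B = c * mip D A B.
Proof.
move=> lA lB; rewrite !mip_sum//; last by apply: L2mxZ => //; exact: tame_cst.
rewrite mulr_sumr; apply: eq_bigr => i _; rewrite mulr_sumr; apply: eq_bigr => j _.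
by rewrite -ipZl//; apply: eq_Rintegral => x _; rewrite mxE.
Qed.

Lemma mipDl A B C : L2mx A -> L2mx B -> L2mx C ->
  mip D (fun x => A x + B x) C = mip D A C + mip D B C.
Proof.
move=> lA lB lC; rewrite !mip_sum//; last exact: L2mxD.
rewrite -big_split /=; apply: eq_bigr => i _; rewrite -big_split /=; apply: eq_bigr => j _.
by rewrite -ipDl//; apply: eq_Rintegral => x _; rewrite mxE.
Qed.

Lemma msqnormZ c A : L2mx A -> msqnorm D (fun x => c *: A x) = c ^+ 2 * msqnorm D A.
Proof.
move=> lA; have lcA : L2mx (fun x => c *: A x) by apply: L2mxZ => //; exact: tame_cst.
by rewrite /msqnorm mipZl// mip_sym mipZl// mulrA expr2.
Qed.

Lemma mip_young e A B : 0 < e -> L2mx A -> L2mx B ->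
  mip D A B <= e * msqnorm D A + (4 * e)^-1 * msqnorm D B.
Proof.
move=> e0 lA lB; rewrite /msqnorm !mip_sum// !mulr_sumr -big_split /=.
apply: ler_sum => i _; rewrite !mulr_sumr -big_split /=; apply: ler_sum => j _.
exact: ip_young.
Qed.

Lemma mip_ge0 A B : (forall x, D x -> 0 <= frob (A x) (B x)) -> 0 <= mip D A B.
Proof. by move=> h; exact: Rintegral_ge0. Qed.

Lemma frob_ge0 (A : 'M[R]_(m, n)) : 0 <= frob A A.
Proof. by rewrite frobE; do 2 (apply: sumr_ge0 => ? _); rewrite -expr2 sqr_ge0. Qed.

Lemma frobZl c (A B : 'M[R]_(m, n)) : frob (c *: A) B = c * frob A B.
Proof. by rewrite /frob linearZ -scalemxAl mxtraceZ. Qed.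

End Matrix.
End Fields.

(** * Finite element fields and transport forms *)

Section FiniteElements.
Context {R : realType}.
Variables (omega : set (R * R)) (m : nat) (G : 'I_m -> R * R -> R * R).
Hypotheses (oomega : open omega) (bomega : bounded_set omega).
Hypothesis conf : conforming_triangulation omega G.
Local Notation D := (mesh_interior omega G).

Let oD : open D. Proof. exact: mesh_interior_open. Qed.
Let fD : (leb2 D < +oo)%E. Proof. exact: mesh_interior_finite. Qed.

(** The polynomial representing a function on an element serves as its extension
    to the plane. *)
Lemma lagrange_piecewise_C1 r s : Defs.lagrange omega G r s -> piecewise_C1 G s.
Proof.
move=> [_ /choice[c hc]].
exists (fun k x => \sum_(i < r.+1) \sum_(j < r.+1 | (i + j <= r)%N)
  c k i j * x.1 ^+ i * x.2 ^+ j) => k; split; last exact: hc.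
apply: C1_plane_sum => i; apply: C1_plane_sum => j.
apply: C1_planeM; last by apply: C1_planeX; exact: C1_plane_snd.
by apply: C1_planeM; [exact: C1_plane_cst|apply: C1_planeX; exact: C1_plane_fst].
Qed.

Lemma piecewise_C1_tame w : piecewise_C1 G w -> tame D w.
Proof.
move=> pw; split; last exact: (piecewise_C1_bounded bomega conf).
by move=> x Dx; apply: locally_C1_continuous; exact: (piecewise_C1_local pw Dx).
Qed.

Lemma piecewise_C1_partial_tame w j : piecewise_C1 G w -> tame D (partial j w).
Proof.
move=> pw; split; last exact: (piecewise_C1_partial_bounded bomega conf).
by move=> x Dx; apply: locally_C1_partial; exact: (piecewise_C1_local pw Dx).
Qed.

Lemma tame_field a : (forall k, piecewise_C1 G (component k a)) -> tamemx D a.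
Proof. by move=> pa i j; rewrite ord1; exact: (piecewise_C1_tame (pa i)). Qed.

Lemma tame_jac a : (forall k, piecewise_C1 G (component k a)) -> tamemx D (jac a).
Proof.
move=> pa i j; under eq_fun do rewrite mxE.
exact: piecewise_C1_partial_tame.
Qed.

Lemma tame_grad s : piecewise_C1 G s -> tamemx D (grad s).
Proof.
by move=> ps i j; under eq_fun do rewrite mxE; exact: piecewise_C1_partial_tame.
Qed.

Lemma dvgE (a : R * R -> 'cV[R]_2) x : dvg a x = \sum_j partial j (component j a) x.
Proof. by rewrite /dvg /mxtrace; apply: eq_bigr => j _; rewrite mxE. Qed.

Lemma tame_dvg a : (forall k, piecewise_C1 G (component k a)) -> tame D (dvg a).
Proof.
move=> pa; rewrite (_ : dvg a = fun x => \sum_j partial j (component j a) x);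
  last by apply/funext => x; exact: dvgE.
by apply: tame_sum => j; exact: piecewise_C1_partial_tame.
Qed.

Lemma ipE f g : ip omega f g = ip D f g.
Proof. exact: (Rintegral_mesh_interior oomega conf). Qed.

Lemma mipE p q (A B : R * R -> 'M[R]_(p, q)) : mip omega A B = mip D A B.
Proof. exact: (Rintegral_mesh_interior oomega conf). Qed.

Section Transport.
Variable a : R * R -> 'cV[R]_2.
Hypotheses (pa : forall k, piecewise_C1 G (component k a))
  (a0 : forall x, bd omega x -> a x = 0).

(** The integrand is half the divergence of [r^2 a], and each component
    [a_j r^2] vanishes on the boundary. *)
Lemma transport_eq0 r : piecewise_C1 G r ->
  \int[leb2]_(x in D) (r x * (\sum_j a x j 0 * partial j r x)
    + 2^-1 * (dvg a x * (r x * r x))) = 0.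
Proof.
move=> pr; pose w j x := component j a x * (r x * r x).
have pw j : piecewise_C1 G (w j) by do 2 apply: piecewise_C1M => //.
transitivity (\int[leb2]_(x in D) (2^-1 * \sum_j partial j (w j) x)).
  apply: eq_Rintegral => x /[!inE] Dx.
  have lr := piecewise_C1_local pr Dx.
  have la j := piecewise_C1_local (pa j) Dx.
  have dr j : derivable r x (dir j) by exact: locally_C1_derivable.
  rewrite dvgE mulr_suml !mulr_sumr -big_split; apply: eq_bigr => j _ /=.
  rewrite partialM; first last.
    by apply: derivableM; exact: dr.
    exact: locally_C1_derivable.
  by rewrite partialM; [rewrite /component; field|exact: dr|exact: dr].
have iw j : leb2.-integrable D (EFin \o partial j (w j)).
  by apply: (tame_integrable oD fD); exact: piecewise_C1_partial_tame.
have [i1 e1] := Rintegral_sum oD fD (index_enum 'I_2) iw.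
rewrite RintegralZl//; last exact: mesh_interior_measurable.
rewrite e1 big1 ?mulr0// => j _.
rewrite -(Rintegral_mesh_interior oomega conf).
apply: (integral_partial_eq0 oomega bomega conf (pw j)) => x bx.
by rewrite /w /component a0// mxE mul0r.
Qed.

Lemma b_phi_eq0 r : piecewise_C1 G r -> b_phi omega a r r = 0.
Proof.
move=> pr; rewrite /b_phi mipE ipE.
have tr := piecewise_C1_tame pr.
have i1 : leb2.-integrable D (EFin \o (fun x => frob (r x *: a x) (grad r x))).
  apply: (tame_integrable oD fD); apply: tame_frob; last exact: tame_grad.
  by apply: tamemxZ => //; exact: tame_field.
have i2 : leb2.-integrable D (EFin \o (fun x => dvg a x * r x * r x)).
  apply: (tame_integrable oD fD); apply: tameM; last exact: tr.
  by apply: tameM; [exact: tame_dvg|exact: tr].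
have mD : measurable (D : set (measurableTypeR R * measurableTypeR R)).
  exact: mesh_interior_measurable.
suff : mip D (fun x => r x *: a x) (grad r) + 2^-1 * ip D (fun x => dvg a x * r x) r = 0.
  by move=> /eqP; rewrite addr_eq0 => /eqP ->; ring.
rewrite /mip /ip -RintegralZl// -RintegralD//; last exact: (integrableZl mD _ i2).
rewrite -[RHS](transport_eq0 pr); apply: eq_Rintegral => x _.
rewrite frobZl frobE mulrA; congr (_ * _ + _); last by rewrite !mulrA.
by apply: eq_bigr => i _; rewrite big_ord1 mxE.
Qed.

Lemma b_vec_eq0 z : (forall k, piecewise_C1 G (component k z)) ->
  b_vec omega a z z = 0.
Proof.
move=> pz; rewrite /b_vec !mipE.
have tz := tame_field pz; have ta := tame_field pa.
have mD : measurable (D : set (measurableTypeR R * measurableTypeR R)).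
  exact: mesh_interior_measurable.
have tJ : tamemx D (fun x => jac z x *m a x).
  move=> i j; under eq_fun do rewrite mxE; apply: tame_sum => k.
  by apply: tameM; [exact: tame_jac|exact: ta].
have i1 : leb2.-integrable D (EFin \o (fun x => frob (jac z x *m a x) (z x))).
  by apply: (tame_integrable oD fD); exact: tame_frob.
have i2 : leb2.-integrable D (EFin \o (fun x => frob (dvg a x *: z x) (z x))).
  by apply: (tame_integrable oD fD); apply: tame_frob; last exact: tz;
    apply: tamemxZ; [exact: tame_dvg|exact: tz].
rewrite /mip -RintegralZl// -RintegralD//; last exact: (integrableZl mD _ i2).
pose F k x := component k z x * (\sum_j a x j 0 * partial j (component k z) x)
    + 2^-1 * (dvg a x * (component k z x * component k z x)).
have iF k : leb2.-integrable D (EFin \o F k).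
  apply: (tame_integrable oD fD); apply: tameD.
    apply: tameM; first exact: piecewise_C1_tame.
    by apply: tame_sum => j; apply: tameM; [exact: ta|exact: piecewise_C1_partial_tame].
  apply: tameM; first exact: tame_cst.
  by apply: tameM; [exact: tame_dvg|apply: tameM; exact: piecewise_C1_tame].
have [_ e] := Rintegral_sum oD fD (index_enum 'I_2) iF.
transitivity (\int[leb2]_(x in D) (\sum_k F k x)).
  apply: eq_Rintegral => x _; rewrite frobZl !frobE !mulr_sumr -big_split.
  apply: eq_bigr => k _; rewrite !big_ord1 /F /component !mxE /=.
  congr (_ + _); rewrite mulrC; congr (_ * _).
  by apply: eq_bigr => j _; rewrite mxE mulrC.
by rewrite e big1// => k _; exact: transport_eq0.
Qed.

End Transport.
End FiniteElements.

(** * Estimates for one step, and the discrete Gronwall inequality *)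

Section Estimates.
Context {R : realType}.
Variable D : set (R * R).
Hypotheses (oD : open D) (fD : (leb2 D < +oo)%E).

Lemma ler_pdiv_step (k x y b c : R) : 0 < k ->
  k^-1 * (x - y) <= c -> y <= 2^-1 * x + 2^-1 * b -> 2^-1 * x <= 2^-1 * b + k * c.
Proof. by move=> k0; rewrite ler_pdivrMl// => h1 h2; lra. Qed.

(** [mm] stands for the product of the gradients of [xi] and [phi1]; the second
    equation expresses it by [|xi|^2], of which one half, in units of
    [tau / lam], is used to absorb the products with [f] and [s]. *)
Lemma phase_estimate (phi0 phi1 xi J f s : R * R -> R) (k tau lam gam al mm : R) :
  L2 D phi0 -> L2 D phi1 -> L2 D xi -> L2 D J -> L2 D f -> L2 D s ->
  0 < k -> 0 < tau -> 0 < lam -> 0 < gam ->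
  ip D (fun x => (phi1 x - phi0 x) / k) phi1 + tau * mm
    = ip D (fun x => al * J x) phi1 ->
  ip D xi xi - lam * mm = lam * gam * ip D f xi + 2^-1 * ip D s xi ->
  2^-1 * sqnorm D phi1 + k * (tau / (4%:R * lam) * sqnorm D xi)
  <= 2^-1 * sqnorm D phi0 + k * (2^-1 * sqnorm D phi1
     + 2^-1 * (al ^+ 2 * sqnorm D J)
     + tau * lam * gam ^+ 2 * sqnorm D f + tau / (4%:R * lam) * sqnorm D s).
Proof.
move=> l0 l1 lx lJ lf ls k0 t0 la0 g0 H1 H2.
have half0 : 0 < 2^-1 :> R by rewrite invr_gt0.
have e1 : ip D (fun x => (phi1 x - phi0 x) / k) phi1 =
    k^-1 * (sqnorm D phi1 - ip D phi0 phi1).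
  transitivity (ip D (fun x => k^-1 * (phi1 x + (-1) * phi0 x)) phi1).
    by apply: eq_Rintegral => x _; congr (_ * _); ring.
  have lm := L2Z oD (-1) l0.
  by rewrite ipZl ?ipDl ?ipZl//; [rewrite /sqnorm; ring|exact: L2D].
have y0 := ip_young oD half0 l0 l1.
have y1 := ip_young oD half0 lJ l1.
have {}y1 : al * ip D J phi1 <= 2^-1 * (al ^+ 2 * sqnorm D J) + 2^-1 * sqnorm D phi1.
  have := ip_young oD half0 (L2Z oD al lJ) l1.
  rewrite ipZl// sqnormZ//.
  by rewrite (_ : (4 * 2^-1)^-1 = 2^-1 :> R)//; field.
(* the weight lam * gam leaves exactly tau / (4 lam) |xi|^2 *)
have y2 := ip_young oD (mulr_gt0 la0 g0) lf lx.
have y3 := ip_young oD half0 ls lx.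
rewrite e1 ipZl// in H1.
have E : tau * mm = tau / lam * (sqnorm D xi - lam * gam * ip D f xi - 2^-1 * ip D s xi).
  have -> : sqnorm D xi - lam * gam * ip D f xi - 2^-1 * ip D s xi = lam * mm.
    by rewrite /sqnorm; lra.
  by field; rewrite gt_eqF.
set A := sqnorm D phi1 in y0 y1 H1 *; set P := ip D phi0 phi1 in y0 H1.
set B := sqnorm D phi0 in y0 *; set X := sqnorm D xi in y2 y3 E *.
have tl0 : 0 < tau / lam by rewrite divr_gt0.
have {}y2 : tau / lam * (lam * gam * ip D f xi) <=
    tau * lam * gam ^+ 2 * sqnorm D f + tau / (4 * lam) * X.
  have c0 : 0 <= tau / lam * (lam * gam) by rewrite ltW// mulr_gt0// mulr_gt0.
  rewrite mulrA; apply: le_trans (ler_wpM2l c0 y2) _.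
  rewrite le_eqVlt; apply/orP; left; apply/eqP; field.
  by rewrite !gt_eqF.
have {}y3 : tau / lam * (2^-1 * ip D s xi) <=
    tau / (4 * lam) * sqnorm D s + tau / (4 * lam) * X.
  have c0 : 0 <= tau / lam * 2^-1 by rewrite ltW// mulr_gt0.
  rewrite mulrA; apply: le_trans (ler_wpM2l c0 y3) _.
  rewrite le_eqVlt; apply/orP; left; apply/eqP; field.
  by rewrite gt_eqF.
have tl4 : tau / lam * X = 4 * (tau / (4 * lam) * X) by field; rewrite gt_eqF.
have X0 : 0 <= tau / (4 * lam) * X.
  rewrite mulr_ge0//; first by rewrite divr_ge0// ltW// mulr_gt0.
  by apply: ip_ge0 => x _; rewrite -expr2 sqr_ge0.
have main : k^-1 * (A - P) <= 2^-1 * A + 2^-1 * (al ^+ 2 * sqnorm D J)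
     + tau * lam * gam ^+ 2 * sqnorm D f + tau / (4 * lam) * sqnorm D s
     - tau / (4 * lam) * X.
  rewrite !mulrBr in E.
  lra.
have h4 : (4 * 2^-1)^-1 = 2^-1 :> R by field.
rewrite h4 in y0.
by have := ler_pdiv_step (b := B) k0 main; rewrite !mulrDr !mulrN => h; have {h} := h _; lra.
Qed.

Lemma mip_youngN (m n : nat) e (A B : R * R -> 'M[R]_(m, n)) : 0 < e ->
  L2mx D A -> L2mx D B ->
  - mip D A B <= e * msqnorm D A + (4 * e)^-1 * msqnorm D B.
Proof.
move=> e0 lA lB.
have lN : L2mx D (fun x => (-1) *: A x) by apply: L2mxZ => //; exact: tame_cst.
have := mip_young oD fD e0 lN lB.
by rewrite mipZl// mulN1r msqnormZ// sqrrN expr1n mul1r.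
Qed.

Lemma mip_young_scaled (m n : nat) al (A B : R * R -> 'M[R]_(m, n)) :
  L2mx D A -> L2mx D B ->
  mip D (fun x => al *: A x) B <=
    2^-1 * (al ^+ 2 * msqnorm D A) + 2^-1 * msqnorm D B.
Proof.
move=> lA lB; have half0 : 0 < 2^-1 :> R by rewrite invr_gt0.
have lN : L2mx D (fun x => al *: A x) by apply: L2mxZ => //; exact: tame_cst.
have := mip_young oD fD half0 lN lB.
by rewrite msqnormZ// (_ : (4 * 2^-1)^-1 = 2^-1 :> R)//; field.
Qed.

Lemma auxiliary_estimate (z0 z1 J : R * R -> 'cV[R]_2) (k al T : R) :
  L2mx D z0 -> L2mx D z1 -> L2mx D J -> 0 < k ->
  mip D (fun x => k^-1 *: (z1 x - z0 x)) z1 + T = mip D (fun x => al *: J x) z1 ->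
  2^-1 * msqnorm D z1 + k * T <= 2^-1 * msqnorm D z0
    + k * (2^-1 * msqnorm D z1 + 2^-1 * (al ^+ 2 * msqnorm D J)).
Proof.
move=> l0 l1 lJ k0 H.
have half0 : 0 < 2^-1 :> R by rewrite invr_gt0.
have e1 : mip D (fun x => k^-1 *: (z1 x - z0 x)) z1 =
    k^-1 * (msqnorm D z1 - mip D z0 z1).
  have lm : L2mx D (fun x => (-1) *: z0 x) by apply: L2mxZ => //; exact: tame_cst.
  transitivity (mip D (fun x => k^-1 *: (z1 x + (-1) *: z0 x)) z1).
    by apply: eq_Rintegral => x _; rewrite scaleN1r.
  by rewrite mipZl ?mipDl ?mipZl//; [rewrite /msqnorm; ring|exact: L2mxD].
have y0 := mip_young oD fD half0 l0 l1.
have y1 := mip_young_scaled al lJ l1.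
have main : k^-1 * (msqnorm D z1 - mip D z0 z1) <=
    2^-1 * msqnorm D z1 + 2^-1 * (al ^+ 2 * msqnorm D J) - T by lra.
have h4 : (4 * 2^-1)^-1 = 2^-1 :> R by field.
rewrite h4 in y0.
by have := ler_pdiv_step (b := msqnorm D z0) k0 main; rewrite !mulrDr !mulrN => h; have {h} := h _; lra.
Qed.

(** The pressure term and the elastic stress are tested against first
    derivatives of the velocity; the weights [2 / em] and [1 / em] make each of
    them cost a quarter of the viscous dissipation [E]. *)
Lemma momentum_estimate (v0 v1 Q S J : R * R -> 'cV[R]_2)
    (V L : R * R -> 'M[R]_2) (p dv : R * R -> R) (k c al em E d : R) :
  L2mx D v0 -> L2mx D v1 -> L2mx D Q -> L2mx D S -> L2mx D J ->
  L2mx D V -> L2mx D L -> L2 D p -> L2 D dv ->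
  0 < k -> 0 < c -> 0 < em -> 0 <= d ->
  em * msqnorm D V <= E -> sqnorm D dv <= 2 * msqnorm D V ->
  mip D (fun x => (c / k) *: v1 x) v1 + E + d =
    mip D (fun x => (c / k) *: v0 x) v1 + ip D p dv + mip D Q v1
    - 2^-1 * mip D S v1 - mip D L V + mip D (fun x => al *: J x) v1 ->
  c / 2 * msqnorm D v1 + k * (2^-1 * E + 2^-1 * d) <=
  c / 2 * msqnorm D v0 + k * (3 / 2 * msqnorm D v1 + 2 / em * sqnorm D p
    + msqnorm D Q + msqnorm D S + 2 / em * msqnorm D L
    + 2^-1 * (al ^+ 2 * msqnorm D J)).
Proof.
move=> l0 l1 lQ lS lJ lV lL lp ldv k0 c0 em0 d0 hE hdv H.
have half0 : 0 < 2^-1 :> R by rewrite invr_gt0.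
have h4 : (4 * 2^-1)^-1 = 2^-1 :> R by field.
rewrite !mipZl// in H.
have y0 := mip_young oD fD half0 l0 l1.
have e20 : 0 < 2 / em by rewrite divr_gt0.
have e10 : 0 < 1 / em by rewrite divr_gt0.
have yp := ip_young oD e20 lp ldv.
have yQ := mip_young oD fD half0 lQ l1.
have yS := mip_youngN half0 lS l1.
have yL := mip_youngN e10 lL lV.
have yJ := mip_young_scaled al lJ l1.
rewrite mipZl// in yJ.
rewrite h4 in y0 yQ yS.
have em1 : (4 * (2 / em))^-1 = em / 8 by field; rewrite gt_eqF.
have em2 : (4 * (1 / em))^-1 = em / 4 by field; rewrite gt_eqF.
rewrite em1 in yp; rewrite em2 in yL.
have {}hdv : em / 8 * sqnorm D dv <= em / 8 * (2 * msqnorm D V).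
  by rewrite ler_pM2l// divr_gt0.
have sq0 m n (A : R * R -> 'M[R]_(m, n)) : 0 <= msqnorm D A.
  by apply: mip_ge0 => x _; exact: frob_ge0.
have A10 := sq0 _ _ v1; have S0 := sq0 _ _ S; have Q0 := sq0 _ _ Q.
have L0 : 0 <= 1 / em * msqnorm D L.
  by apply: mulr_ge0 (sq0 _ _ L); rewrite ltW// divr_gt0.
have em3 : 2 / em * msqnorm D L = 2 * (1 / em * msqnorm D L) by field; rewrite gt_eqF.
set A1 := msqnorm D v1 in y0 yQ yS yJ A10 *; set A0 := msqnorm D v0 in y0 *.
set W := mip D v0 v1 in H y0.
have main : k^-1 * (c * A1 - c * W) <= 3 / 2 * A1 + 2 / em * sqnorm D p
    + msqnorm D Q + msqnorm D S + 2 / em * msqnorm D L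
    + 2^-1 * (al ^+ 2 * msqnorm D J) - (2^-1 * E + 2^-1 * d).
  have : c / k * mip D v1 v1 = k^-1 * (c * A1) by rewrite /A1 /msqnorm; field; rewrite gt_eqF.
  have : c / k * W = k^-1 * (c * W) by field; rewrite gt_eqF.
  rewrite mulrBr em3; lra.
have cW : c * W <= 2^-1 * (c * A1) + 2^-1 * (c * A0).
  by have := ler_wpM2l (ltW c0) y0; lra.
have := ler_pdiv_step k0 main cW; rewrite mulrBr; lra.
Qed.

(** With [x = c1 k <= 1/2] one has [1 <= (1 + 2 x) (1 - x)], so the new energy on
    the right can be moved to the left at the price of the factor [1 + 2 x]. *)
Lemma implicit_euler_step (E0 E1 Dn S k c1 c2 : R) :
  0 < c1 -> 0 <= c2 -> 0 <= E0 -> 0 <= E1 -> 0 <= Dn -> 0 <= S ->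
  0 < k <= (2 * c1)^-1 ->
  E1 + k * Dn <= E0 + k * (c1 * E1 + c2 * S) ->
  E1 + k * Dn <= (1 + 2 * (c1 + c2) * k) * E0 + 2 * (c1 + c2) * k * S.
Proof.
move=> c10 c20 E00 E10 D0 S0 /andP[k0 kc] H.
have {kc} x2 : c1 * k <= 2^-1.
  apply: le_trans (ler_wpM2l (ltW c10) kc) _.
  by rewrite le_eqVlt; apply/orP; left; apply/eqP; field; rewrite gt_eqF.
have x0 : 0 < c1 * k by rewrite mulr_gt0.
set x := c1 * k in x0 x2.
have kD : 0 <= k * Dn by rewrite mulr_ge0// ltW.
have kS : 0 <= k * (c2 * S) by rewrite !mulr_ge0// ltW.
have kcE : 0 <= k * (c2 * E0) by rewrite !mulr_ge0// ltW.
have xS : 0 <= x * S by rewrite mulr_ge0// ltW.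
set T := E1 + k * Dn in H *.
have T0 : 0 <= T by rewrite addr_ge0.
have h1 : (1 - x) * T <= E0 + k * (c2 * S).
  have h : 0 <= x * (k * Dn) by rewrite mulr_ge0// ltW.
  have E : k * (c1 * E1) = x * E1 by rewrite /x; ring.
  have -> : (1 - x) * T = T - x * E1 - x * (k * Dn) by rewrite /T; ring.
  by rewrite mulrDr E in H; lra.
have h2 : T <= (1 + 2 * x) * ((1 - x) * T).
  have h : 0 <= x * (1 - 2 * x) * T.
    by apply: mulr_ge0 T0; apply: mulr_ge0 (ltW x0) _; lra.
  rewrite -subr_ge0 (_ : _ - _ = x * (1 - 2 * x) * T)//; ring.
have h3 : (1 + 2 * x) * ((1 - x) * T) <= (1 + 2 * x) * (E0 + k * (c2 * S)).
  by apply: ler_wpM2l h1; lra.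
have h4 : (1 + 2 * x) * (k * (c2 * S)) <= 2 * (k * (c2 * S)).
  by apply: ler_wpM2r kS _ _ _; lra.
apply: le_trans h2 (le_trans h3 _).
have -> : (1 + 2 * (c1 + c2) * k) * E0 = (1 + 2 * x) * E0 + 2 * (k * (c2 * E0)).
  by rewrite /x; ring.
have -> : 2 * (c1 + c2) * k * S = 2 * (x * S) + 2 * (k * (c2 * S)) by rewrite /x; ring.
rewrite mulrDr; lra.
Qed.

(** Induction gives the bound with [(1 + C k) ^+ j] in place of the exponential;
    the dissipation already summed is multiplied by a factor at least one. *)
Lemma discrete_gronwall (E Dn S : nat -> R) (k C : R) (N : nat) :
  0 <= k -> 0 <= C -> (forall n, 0 <= E n) -> (forall n, 0 <= Dn n) ->
  (forall n, 0 <= S n) ->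
  (forall n, (n < N)%N ->
    E n.+1 + k * Dn n.+1 <= (1 + C * k) * E n + C * k * S n) ->
  forall j, (j <= N)%N ->
  E j + k * \sum_(0 <= n < j) Dn n.+1 <=
    expR (C * (N%:R * k)) * (E 0%N + C * k * \sum_(0 <= n < j) S n).
Proof.
move=> k0 C0 E0 D0 S0 step.
have Ck0 : 0 <= C * k by rewrite mulr_ge0.
have sumS0 j : 0 <= \sum_(0 <= n < j) S n by apply: sumr_ge0.
have kD0 j : 0 <= k * \sum_(0 <= n < j) Dn n.+1 by rewrite mulr_ge0// sumr_ge0.
have iter j : (j <= N)%N -> E j + k * \sum_(0 <= n < j) Dn n.+1 <=
    (1 + C * k) ^+ j * (E 0%N + C * k * \sum_(0 <= n < j) S n).
  elim: j => [_|j IHj jN]; first by rewrite !big_nil !mulr0 !addr0 mul1r.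
  have {}IHj := IHj (ltnW jN).
  rewrite !big_nat_recr//=; set sD := \sum_(0 <= n < j) _ in IHj *.
  set sS := \sum_(0 <= n < j) _ in IHj *.
  set q := 1 + C * k; have q1 : 1 <= q by rewrite /q lerDl.
  have h1 := step j jN; rewrite -/q in h1 IHj.
  have h2 : q * (E j + k * sD) <= q * (q ^+ j * (E 0%N + C * k * sS)).
    by apply: ler_wpM2l => //; lra.
  have h3 : k * sD <= q * (k * sD) by rewrite ler_peMl// kD0.
  have h4 : C * k * S j <= q ^+ j.+1 * (C * k * S j).
    by rewrite ler_peMl ?mulr_ge0// exprn_ege1.
  rewrite !mulrA -exprS -!mulrA in h2.
  rewrite !mulrDr; rewrite !mulrDr in h2; rewrite !mulrA in h1 h2 h3 h4 *; lra.
move=> j jN; apply: le_trans (iter j jN) _.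
apply: ler_wpM2r; first by rewrite addr_ge0// mulr_ge0.
apply: (@le_trans _ _ (expR (C * k) ^+ j)).
  by rewrite lerXn2r ?nnegrE ?expR_ge0 ?expR_ge1Dx// addr_ge0.
rewrite -expRM_natl ler_expR.
by rewrite (_ : C * (N%:R * k) = N%:R * (C * k)); [rewrite ler_wpM2r// ler_nat|ring].
Qed.

End Estimates.

(** * Coefficients and the energy inequality *)

Section Coefficients.
Context {R : realType}.

Lemma trunc_itv (s : R) : 0 <= trunc s <= 1.
Proof. by rewrite /trunc le_min ge_min lexx ler01 le_max lexx. Qed.

Lemma trunc_continuous : continuous (@trunc R).
Proof.
move=> s; apply: (@continuous_min _ _ (cst 1) (fun s : R => Num.max 0 s)).
  exact: cst_continuous.
apply: (@continuous_max _ _ (cst 0) id); first exact: cst_continuous.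
exact: cvg_id.
Qed.

Lemma C1_continuous (g : R -> R) : C1 g -> continuous g.
Proof.
by move=> [dg _] s; apply: differentiable_continuous; exact/derivable1_diffP/dg.
Qed.

Variable D : set (R * R).
Hypotheses (oD : open D) (fD : (leb2 D < +oo)%E).

Lemma L2_subset (U : set (R * R)) f : measurable U -> D `<=` U -> L2 U f -> L2 D f.
Proof.
move=> mU DU [mf f2]; split; first exact: measurable_funS mf.
by apply: integrableS f2 => //; exact: open_measurable2.
Qed.

Lemma tamemx_gram (J : R * R -> 'M[R]_2) : tamemx D J ->
  tamemx D (fun x => (J x)^T *m J x).
Proof.
move=> tJ i j; under eq_fun do rewrite mxE; apply: tame_sum => k.
by under eq_fun do rewrite mxE; apply: tameM; exact: tJ.
Qed.

Lemma mip_weight_ge (w : R * R -> R) (J : R * R -> 'M[R]_2) (e : R) :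
  tame D w -> tamemx D J -> (forall x, e <= w x) ->
  e * msqnorm D J <= mip D (fun x => w x *: J x) J.
Proof.
move=> tw tJ ew; rewrite -mipZl//; try exact: tame_L2mx.
have mD := open_measurable2 oD.
apply: le_Rintegral.
- exact: mD.
- apply: (tame_integrable oD fD); apply: tame_frob; last exact: tJ.
  by apply: tamemxZ; [exact: tame_cst|exact: tJ].
- apply: (tame_integrable oD fD); apply: tame_frob; last exact: tJ.
  by apply: tamemxZ; [exact: tw|exact: tJ].
- by move=> x _; rewrite !frobZl ler_wpM2r// frob_ge0.
Qed.

(** The trace of a 2 x 2 matrix is a sum of two entries, whence the factor 2. *)
Lemma sqnorm_dvg_le (a : R * R -> 'cV[R]_2) : tamemx D (jac a) -> tame D (dvg a) ->
  sqnorm D (dvg a) <= 2 * msqnorm D (jac a).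
Proof.
move=> tJ td; have mD := open_measurable2 oD.
have iJ : leb2.-integrable D (EFin \o (fun x => frob (jac a x) (jac a x))).
  by apply: (tame_integrable oD fD); apply: tame_frob; exact: tJ.
rewrite /sqnorm /ip /msqnorm /mip -RintegralZl; last 2 first.
- exact: mD.
- exact: iJ.
apply: le_Rintegral.
- exact: mD.
- by apply: (tame_integrable oD fD); apply: tameM; exact: td.
- by apply: (integrableZl _ _ iJ); exact: mD.
- move=> x _; rewrite frobE /dvg /mxtrace !big_ord_recl !big_ord0 !addr0.
  set p := jac a x ord0 ord0; set q := jac a x (lift ord0 ord0) (lift ord0 ord0).
  have := sqr_ge0 (p - q); have := sqr_ge0 (jac a x ord0 (lift ord0 ord0)).
  have := sqr_ge0 (jac a x (lift ord0 ord0) ord0).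
  lra.
Qed.

(** Adding the three estimates.  The coefficient 3/2 of [V1] is [3 / c] times its
    coefficient in the energy, which fixes [c1 = 1 + 3 / c]; the other
    coefficient majorizes all weights of the source terms. *)
Lemma energy_balance (k c a b g e A0 A1 M0 M1 V0 V1 X E d T SI SJ SU Sf Ss Sp SQ SS SL : R) :
  0 < k -> 0 < c -> 0 <= a -> 0 <= b -> 0 <= g ->
  0 <= A1 -> 0 <= M1 -> 0 <= V1 ->
  0 <= SI -> 0 <= SJ -> 0 <= SU -> 0 <= Sf -> 0 <= Ss -> 0 <= Sp ->
  0 <= SQ -> 0 <= SS -> 0 <= SL ->
  2^-1 * A1 + k * (b * X) <=
    2^-1 * A0 + k * (2^-1 * A1 + 2^-1 * SI + a * Sf + b * Ss) ->
  2^-1 * M1 + k * (e * T) <= 2^-1 * M0 + k * (2^-1 * M1 + 2^-1 * SJ) ->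
  c / 2 * V1 + k * (2^-1 * E + 2^-1 * d) <= c / 2 * V0 +
    k * (3 / 2 * V1 + g * Sp + SQ + SS + g * SL + 2^-1 * SU) ->
  c / 2 * V1 + 2^-1 * A1 + 2^-1 * M1
    + k * (b * X + 2^-1 * E + 2^-1 * d + e * T) <=
  c / 2 * V0 + 2^-1 * A0 + 2^-1 * M0 +
    k * ((1 + 3 / c) * (c / 2 * V1 + 2^-1 * A1 + 2^-1 * M1)
         + (1 + a + b + g) * (SI + SJ + SU + Sf + Ss + Sp + SQ + SS + SL)).
Proof.
move=> k0 c0 a0 b0 g0 A10 M10 V10 SI0 SJ0 SU0 Sf0 Ss0 Sp0 SQ0 SS0 SL0 h1 h2 h3.
set S := SI + SJ + SU + Sf + Ss + Sp + SQ + SS + SL.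
have aS : a * Sf <= a * S by apply: ler_wpM2l => //; rewrite /S; lra.
have bS : b * Ss <= b * S by apply: ler_wpM2l => //; rewrite /S; lra.
have gS : g * (Sp + SL) <= g * S by apply: ler_wpM2l => //; rewrite /S; lra.
have cE : (1 + 3 / c) * (c / 2 * V1 + 2^-1 * A1 + 2^-1 * M1) =
    c / 2 * V1 + 2^-1 * A1 + 2^-1 * M1 + 3 / 2 * V1 + 3 / c * (2^-1 * A1 + 2^-1 * M1).
  by field; rewrite gt_eqF.
have cV : 0 <= c / 2 * V1 by rewrite mulr_ge0// divr_ge0// ltW.
have cAM : 0 <= 3 / c * (2^-1 * A1 + 2^-1 * M1).
  by rewrite mulr_ge0 ?divr_ge0 ?addr_ge0 ?mulr_ge0 ?invr_ge0// ltW.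
have key : (2^-1 * A1 + 2^-1 * SI + a * Sf + b * Ss) + (2^-1 * M1 + 2^-1 * SJ)
    + (3 / 2 * V1 + g * Sp + SQ + SS + g * SL + 2^-1 * SU) <=
    (1 + 3 / c) * (c / 2 * V1 + 2^-1 * A1 + 2^-1 * M1) + (1 + a + b + g) * S.
  by rewrite cE !mulrDl mul1r {1}/S; rewrite mulrDr in gS; lra.
have := ler_wpM2l (ltW k0) key; lra.
Qed.

End Coefficients.

(** The estimates for the three substeps on [mesh_interior], added up. *)
Lemma energy_step (R : realType) (omega : set (R * R)) (m : nat)
    (G : 'I_m -> R * R -> R * R) (P : physical R) (A : nudging R)
    (M : material R) (IH : (R * R -> R) -> R * R -> R) (ref : reference R)
    (dt : R) (sol : iterates R) (n : nat) (eta_min : R)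
    (c := par_rho P * par_Re P)
    (a := par_tau P * par_lambda P * par_gamma P ^+ 2)
    (b := par_tau P / (4%:R * par_lambda P)) (g := 2 / eta_min) :
  open omega -> bounded_set omega -> conforming_triangulation omega G ->
  0 < c -> 0 < par_tau P -> 0 < par_lambda P -> 0 < par_gamma P ->
  0 < eta_min -> 0 < dt ->
  continuous (mat_eta M) -> continuous (mat_nu M) ->
  continuous (derive1 (mat_nu M)) -> continuous (derive1 (mat_F M)) ->
  (forall s, 0 <= s <= 1 -> eta_min <= mat_eta M s) ->
  0 <= mip omega (drag M sol n.+1) (it_v sol n.+1) ->
  L2 omega (IH (phi_err ref dt sol n)) ->
  (forall k, L2 omega (IH (component k (psi_err ref dt sol n)))) ->
  (forall k, L2 omega (IH (component k (u_err ref dt sol n)))) ->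
  vecVh omega G (it_v sol n) -> vecVh omega G (it_v sol n.+1) ->
  Vh omega G (it_phi sol n) -> Vh omega G (it_phi sol n.+1) ->
  vecWh omega G (it_zeta sol n) -> vecWh omega G (it_zeta sol n.+1) ->
  tame (mesh_interior omega G) (p_extrap sol n) ->
  Vh omega G (it_xi sol n.+1) ->
  cahn_hilliard_step omega G P A M IH ref dt sol n ->
  auxiliary_step omega G P A M IH ref dt sol n ->
  navier_stokes_step omega G P A M IH ref dt sol n ->
  energy omega P sol n.+1 + dt * dissipation omega P M sol n.+1
  <= energy omega P sol n + dt * ((1 + 3 / c) * energy omega P sol n.+1
     + (1 + a + b + g) * source omega A M IH ref dt sol n).
Proof.
move=> oomega bomega conf c0 tau0 lam0 gam0 em0 k0 ceta cnu cdnu cF etab drag0.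
move=> LIphi LIpsi LIu [Wv0 bv0] Wv1 Vphi0 Vphi1 Wz0 Wz1 tp Vxi ch aux ns.
have mE := mipE oomega conf; have iE := ipE oomega conf.
set D := mesh_interior omega G in tp.
have oD : open D by exact: mesh_interior_open.
have fD : (leb2 D < +oo)%E by exact: mesh_interior_finite.
have DU : D `<=` omega by move=> x [].
have mU : measurable omega by exact: open_measurable2.
have pwV s : Vh omega G s -> piecewise_C1 G s by exact: lagrange_piecewise_C1.
have tameV s : Vh omega G s -> tame D s.
  by move=> /pwV; exact: (piecewise_C1_tame bomega conf).
have pwW z : vecWh omega G z -> forall k, piecewise_C1 G (component k z).
  by move=> wz k; exact/pwV/wz.
have tameW z : vecWh omega G z -> tamemx D z.
  by move=> /pwW; exact: (tame_field bomega conf).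
have tameJ z : vecWh omega G z -> tamemx D (jac z).
  by move=> /pwW; exact: (tame_jac bomega conf).
have tameg s : Vh omega G s -> tamemx D (grad s).
  by move=> /pwV; exact: (tame_grad bomega conf).
have thphi k : Vh omega G (it_phi sol k) -> tame D (hphi sol k).
  by move=> /tameV; apply: tame_comp; exact: trunc_continuous.
have tstress k l : Vh omega G (it_phi sol k) -> vecWh omega G (it_zeta sol l) ->
    tame D (nu_stress M sol k l).
  move=> vk wl; apply: tameM; first by apply: (tame_comp cdnu); exact: thphi.
  by apply: tame_frob; exact: tameJ.
have LIvec e : (forall k, L2 omega (IH (component k e))) -> L2mx D (IHvec IH e).
  move=> Le i j; rewrite (_ : (fun _ => _) = IH (component i e)).
    exact: L2_subset (Le i).
  by apply/funext => x; rewrite mxE.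
have [Wv1' bv1] := Wv1.
(* Testing with phi^(n+1) and xi^(n+1) removes the transport term. *)
have [ch1 ch2] := ch _ _ Vphi1 Vxi.
rewrite (b_phi_eq0 oomega bomega conf (pwW _ Wv0) bv0 (pwV _ Vphi1)) addr0 in ch1.
rewrite !iE mE in ch1; rewrite !iE mE mip_sym in ch2.
have E1 := phase_estimate oD (tame_L2 oD fD (tameV _ Vphi0))
  (tame_L2 oD fD (tameV _ Vphi1)) (tame_L2 oD fD (tameV _ Vxi))
  (L2_subset oD mU DU LIphi)
  (tame_L2 oD fD (tame_comp cF (thphi _ Vphi0)))
  (tame_L2 oD fD (tstress _ _ Vphi0 Wz0)) k0 tau0 lam0 gam0 ch1 ch2.
have aux1 := aux _ Wz1.
rewrite (b_vec_eq0 oomega bomega conf (pwW _ Wv0) bv0 (pwW _ Wz1)) addr0 !mE in aux1.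
have E2 := auxiliary_estimate oD fD (tame_L2mx oD fD (tameW _ Wz0))
  (tame_L2mx oD fD (tameW _ Wz1)) (LIvec _ LIpsi) k0 aux1.
have ns1 := ns _ Wv1.
rewrite (b_vec_eq0 oomega bomega conf (pwW _ Wv0) bv0 (pwW _ Wv1')) mulr0 addr0 in ns1.
rewrite mE in drag0; rewrite !mE iE in ns1.
have tdv : tame D (dvg (it_v sol n.+1)) by exact: (tame_dvg bomega conf (pwW _ Wv1')).
have visc : eta_min * msqnorm D (jac (it_v sol n.+1)) <=
    mip D (fun x => mat_eta M (hphi sol n.+1 x) *: jac (it_v sol n.+1) x)
      (jac (it_v sol n.+1)).
  apply: mip_weight_ge => //; last by move=> x; apply: etab; exact: trunc_itv.
    by apply: (tame_comp ceta); exact: thphi.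
  exact: tameJ.
have tQ : tamemx D (fun x => it_xi sol n.+1 x *: grad (it_phi sol n.+1) x).
  by apply: tamemxZ; [exact: tameV|exact: tameg].
have tS : tamemx D (fun x => nu_stress M sol n.+1 n.+1 x *: grad (it_phi sol n.+1) x).
  by apply: tamemxZ; [exact: tstress|exact: tameg].
have tL : tamemx D (elastic M sol n.+1).
  apply: tamemxZ; first by apply: (tame_comp cnu); exact: thphi.
  by apply: tamemx_gram; exact: tameJ.
have E3 := momentum_estimate oD fD (tame_L2mx oD fD (tameW _ Wv0))
  (tame_L2mx oD fD (tameW _ Wv1')) (tame_L2mx oD fD tQ) (tame_L2mx oD fD tS)
  (LIvec _ LIu) (tame_L2mx oD fD (tameJ _ Wv1')) (tame_L2mx oD fD tL)
  (tame_L2 oD fD tp) (tame_L2 oD fD tdv) k0 c0 em0 drag0 visc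
  (sqnorm_dvg_le oD fD (tameJ _ Wv1') tdv) ns1.
have sq0 f : 0 <= sqnorm D f.
  by apply: Rintegral_ge0 => x _; rewrite -expr2 sqr_ge0.
have msq0 p q (B : R * R -> 'M[R]_(p, q)) : 0 <= msqnorm D B.
  by apply: Rintegral_ge0 => x _; exact: frob_ge0.
have b0 : 0 <= b by rewrite divr_ge0 ?mulr_ge0 ?ltW.
have a0 : 0 <= a by rewrite !mulr_ge0 ?sqr_ge0 ?ltW.
have g0 : 0 <= g by rewrite divr_ge0 ?ltW.
rewrite /energy /dissipation /source /sqnorm /msqnorm !iE !mE.
have sc0 (t y : R) : 0 <= y -> 0 <= t ^+ 2 * y by apply: mulr_ge0; exact: sqr_ge0.
by apply: (energy_balance k0 c0 a0 b0 g0 _ _ _ _ _ _ _ _ _ _ _ _ E1 E2 E3);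
  do ?apply: sc0; (exact: sq0 || exact: msq0).
Qed.


Theorem theorem3p2 (R : realType) (omega : set (R * R))
  (rho Re tau lambda eps gamma : R)
  (eta_min eta_max nu_max kappa_min : R) :
  admissible_domain omega ->
  0 < rho -> 0 < Re -> 0 < tau -> 0 < lambda -> 0 < eps -> 0 < gamma ->
  0 < eta_min -> 0 < kappa_min ->
  exists C dt0 : R, [/\ 0 < C, 0 < dt0 &
  forall (m : nat) (G : 'I_m -> R * R -> R * R)
    (A : nudging R) (M : material R) (nu_min kappa_max : R)
    (c0 delta : R) (dom : set (R * R -> R))
    (IH : (R * R -> R) -> R * R -> R) (ref : reference R)
    (dt : R) (N : nat) (sol : iterates R),
  let P := Physical rho Re lambda gamma tau eps in
  conforming_triangulation omega G ->
  0 <= nud_u A -> 0 <= nud_phi A -> 0 <= nud_psi A ->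
  C1_bounded (mat_eta M) -> C1_bounded (mat_nu M) -> C1_bounded (mat_kappa M) ->
  C2 (mat_F M) -> double_well (mat_F M) -> potential_growth (mat_F M) ->
  0 <= nu_min ->
  (forall s, 0 <= s <= 1 ->
     [/\ eta_min <= mat_eta M s <= eta_max, nu_min <= mat_nu M s <= nu_max &
         kappa_min <= mat_kappa M s <= kappa_max]) ->
  0 < c0 -> 0 < delta -> observation_operator omega c0 delta dom IH ->
  0 < dt <= dt0 ->
  generated_by_scheme omega G P A M IH ref dt sol N ->
  (forall n, (n < N)%N -> observable ref dt sol dom n) ->
  (forall n, (n < N)%N ->
     energy omega P sol n.+1 + dt * dissipation omega P M sol n.+1
     <= (1 + C * dt) * energy omega P sol n
        + C * dt * source omega A M IH ref dt sol n) /\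
  (forall T : R, T = N%:R * dt -> forall k : nat, (k <= N)%N ->
     energy omega P sol k
     + dt * \sum_(0 <= n < k) dissipation omega P M sol n.+1
     <= expR (C * T)
        * (energy omega P sol 0
           + C * dt * \sum_(0 <= n < k) source omega A M IH ref dt sol n))].
Proof.
move=> [oomega _ _ bomega _] rho0 Re0 tau0 lam0 eps0 gam0 em0 km0.
pose c := rho * Re; have cpos : 0 < c by rewrite mulr_gt0.
pose a := tau * lambda * gamma ^+ 2; pose b := tau / (4%:R * lambda).
pose g := 2 / eta_min; pose c1 := 1 + 3 / c; pose c2 := 1 + a + b + g.
have a0 : 0 <= a by rewrite !mulr_ge0 ?sqr_ge0 ?ltW.
have b0 : 0 <= b by rewrite divr_ge0 ?mulr_ge0 ?ltW.
have g0 : 0 <= g by rewrite divr_ge0 ?ltW.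
have c10 : 0 < c1 by rewrite ltr_pwDl// divr_ge0// ltW.
have c20 : 0 <= c2 by rewrite /c2 !addr_ge0.
have C0 : 0 < 2 * (c1 + c2) by rewrite mulr_gt0// ltr_pwDl.
exists (2 * (c1 + c2)), (2 * c1)^-1; split => //.
  by rewrite invr_gt0 mulr_gt0.
move=> m G A M nu_min kappa_max q0 delta dom IH ref dt N sol P conf _ _ _
  [eta1 _] [nu1 _] _ [[_ cF] _] _ _ nu0 bounds _ _ [_ IHL2 _ _ _] /andP[k0 kdt]
  [Qinit hit hxi hstep] hobs.
have mE := mipE oomega conf; have iE := ipE oomega conf.
pose D := mesh_interior omega G.
have oD : open D by exact: mesh_interior_open.
have fD : (leb2 D < +oo)%E by exact: mesh_interior_finite.
have sq0 f : 0 <= sqnorm omega f.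
  by apply: Rintegral_ge0 => x _; rewrite -expr2 sqr_ge0.
have msq0 p q (B : R * R -> 'M[R]_(p, q)) : 0 <= msqnorm omega B.
  by apply: Rintegral_ge0 => x _; exact: frob_ge0.
have hb n x := bounds _ (trunc_itv (it_phi sol n x)).
have drag0 n : 0 <= mip omega (drag M sol n) (it_v sol n).
  apply: Rintegral_ge0 => x _; rewrite frobZl mulr_ge0 ?frob_ge0//.
  have [/andP[e1 _] _ /andP[k1 _]] := hb n x.
  have /andP[_ t1] := trunc_itv (it_phi sol n x).
  by rewrite mulr_ge0 ?subr_ge0// divr_ge0// ?(le_trans _ e1) ?(le_trans _ k1)// ltW.
have visc0 n : 0 <= mip omega (fun x => mat_eta M (hphi sol n x) *: jac (it_v sol n) x)
    (jac (it_v sol n)).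
  apply: Rintegral_ge0 => x _; rewrite frobZl mulr_ge0 ?frob_ge0//.
  by have [/andP[e1 _] _ _] := hb n x; rewrite (le_trans _ e1)// ltW.
have aux0 n : 0 <= mip omega (fun x => mat_nu M (hphi sol n x) *: jac (it_zeta sol n) x)
    (jac (it_zeta sol n)).
  apply: Rintegral_ge0 => x _; rewrite frobZl mulr_ge0 ?frob_ge0//.
  by have [_ /andP[e1 _] _] := hb n x; rewrite (le_trans _ e1).
have energy0 n : 0 <= energy omega P sol n.
  by rewrite /energy !addr_ge0// mulr_ge0// divr_ge0// ltW.
have diss0 n : 0 <= dissipation omega P M sol n.
  by rewrite /dissipation !addr_ge0// mulr_ge0//= ltW.
have source0 n : 0 <= source omega A M IH ref dt sol n.
  by rewrite /source !addr_ge0// mulr_ge0// sqr_ge0.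
have step n : (n < N)%N ->
    energy omega P sol n.+1 + dt * dissipation omega P M sol n.+1
    <= energy omega P sol n + dt * (c1 * energy omega P sol n.+1
       + c2 * source omega A M IH ref dt sol n).
  move=> nN; have nN' : (n <= N)%N := ltnW nN.
  have [Wv0 Qp Vphi0 Wz0] := hit n nN'; have [Wv1 _ Vphi1 Wz1] := hit n.+1 nN.
  have [obs_phi obs_vec] := hobs n nN; have [ch aux ns _] := hstep n nN.
  apply: (energy_step oomega bomega conf) => //.
  - exact: C1_continuous.
  - exact: C1_continuous.
  - by case: nu1.
  - by move=> s /bounds[/andP[]].
  - exact: IHL2.
  - by move=> k; apply: IHL2; have [] := obs_vec k.
  - by move=> k; apply: IHL2; have [] := obs_vec k.
  - have tq q : Qh0 omega G q -> tame D q.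
      by move=> [/lagrange_piecewise_C1 pq _]; exact: (piecewise_C1_tame bomega conf).
    apply: tameB; first by apply: tameM; [exact: tame_cst|exact: tq].
    case: n nN nN' {Wv0 Qp Vphi0 Wz0 Wv1 Vphi1 Wz1 obs_phi obs_vec ch aux ns} => [|n] nN nN'.
      exact: tq.
    by apply: tq; have [] := hit n (ltnW nN').
  - exact: hxi.
have one n : (n < N)%N ->
     energy omega P sol n.+1 + dt * dissipation omega P M sol n.+1
     <= (1 + 2 * (c1 + c2) * dt) * energy omega P sol n
        + 2 * (c1 + c2) * dt * source omega A M IH ref dt sol n.
  move=> nN; apply: implicit_euler_step => //; last exact: step.
  by rewrite k0.
split => // T -> j jN.
by apply: (discrete_gronwall _ _ energy0 diss0 source0 one jN); rewrite ltW.
Qed.
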